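(* Let $f$ be a real-valued polynomial of degree $1$, $q$ a prime and $\chi$ a non-principal multiplicative character modulo $q$. Then for every integer $r \ge 2$, every real $H < q^{\frac{1}{2} + \frac{1}{4(r-1)}}$ and every $\varepsilon > 0$, \[ \sum_{N<n \le N+H} e(f(n))\chi(n) \ll_{r,\varepsilon} H^{1-\frac{1}{r}} q^{\frac{1}{4(r-1)} + \varepsilon}, \] uniformly in $N$.
   Context: $e(t) = e^{2\pi i t}$. The sum runs over integers $n \in (N,N+H]$; the implied constant depends only on $r$ and $\varepsilon$. *)

(* Defs.v *)
From HB Require Import structures.
From mathcomp Require Import all_boot all_order all_algebra.
From mathcomp Require Import complex.
From mathcomp Require Import all_classical all_reals all_analysis.

Set Implicit Arguments.
Unset Strict Implicit.
Unset Printing Implicit Defensive.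

Import Order.TTheory GRing.Theory Num.Theory.
Local Open Scope ring_scope.
Local Open Scope complex_scope.

(* e^{2 pi i t} by Euler's formula. *)
Definition e (R : realType) (t : R) : R[i] :=
  cos (2 * pi * t) +i* sin (2 * pi * t).

(* A function on Z that is periodic modulo q is a function on 'F_q. The last
   condition is the usual extension by zero to the multiples of q: it is not
   implied by the first one, since the constant function 1 satisfies that. *)
Definition multiplicative_character (R : realType) (q : nat)
    (chi : 'F_q -> R[i]) : Prop :=
  monoid_morphism chi /\ chi 0 = 0.

Definition principal (R : realType) (q : nat) (chi : 'F_q -> R[i]) : Prop :=
  forall x : 'F_q, x != 0 -> chi x = 1.

(* The index set is always finite, so the finitely supported sum below is the
   plain finite sum over the integers of (N, N + H]. *)
Definition mixed_character_sum (R : realType) (f : {poly R}) (q : nat)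
    (chi : 'F_q -> R[i]) (N H : R) : R[i] :=
  \sum_(n \in [set n : int | N < n%:~R <= N + H])
    e f.[n%:~R] * chi n%:~R.

(* Main.v *)
(* Burgess' method. The sum S over (N, N + H] is compared with its translates by
   a * b, A <= a < 2 A, b < B; writing n + a b = a (n / a + b), the phase becomes
   e(alpha a b). Each alpha a is replaced by the nearest t / B below it, at the
   cost of an Abel summation, and Hoelder's inequality is applied with the sum
   over all pairs (x, t) in F_q x Z/B. The extra average over t makes the 2r-th
   moment of sum_b w_b e(t b / B) chi(x + b) gain a factor B off the diagonal,
   which is where H < q^(1/2 + 1/(4(r - 1))) comes from. The edges of the
   translates are absorbed by induction on H.

   The moment needs Weil's bound for sums of products of chi(x + b_i) and
   conjugates of these. It follows from Stepanov's method in Bombieri's form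
   over the fields with q^(2m) elements, and from the rationality of the
   L-function: monic polynomials g of large degree take all tuples of values
   (g(b_i))_i equally often, so L is a polynomial and the sums over the extension
   fields are the power sums of its reciprocal roots; the bounds for large m
   confine these to |w| <= sqrt q. *)
Require Import Defs.
From HB Require Import structures.
From mathcomp Require Import all_boot all_order all_algebra.
From mathcomp Require Import all_solvable all_field zify ring lra.
From mathcomp Require Import complex.
From mathcomp Require Import all_classical all_reals all_analysis.

Set Implicit Arguments.
Unset Strict Implicit.
Unset Printing Implicit Defensive.

Import Order.TTheory GRing.Theory Num.Theory.
Local Open Scope ring_scope.
Local Open Scope complex_scope.

(** * Stepanov's auxiliary polynomial *)

(** The frequency therefore joins the summation variable, with finitely many values; the spacing 1 /
    B suffices because b < B leaves a residual phase of bounded variation. A pair (x, t) never has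
    more coincidences than x alone, so the enlargement is free on that side, while in the moment the
    sum over t becomes a congruence modulo B on the signed sum of the b's, satisfied by one tuple in
    B. The smaller off-diagonal part permits the larger choice of B, about q ^ (1 / (2 (r - 1))),
    and the requirement 4 A H <= q, with A about H / B, then gives the range of H. The only source
    of q ^ eps is a harmonic sum in the count of coincidences.

    Stepanov's argument needs the square root of Q to be a power of the characteristic, hence fields
    of even degree over F_q; they control the squares of the reciprocal roots, which is enough. *)

Lemma polys_dependent (K : fieldType) (I : finType) (n : nat) (G : I -> {poly K}) :
  (forall i, (size (G i) <= n)%N) -> (n < #|I|)%N ->
  exists2 v : I -> K, (exists i, v i != 0) & \sum_i v i *: G i = 0.
Proof.
move=> sG nI.
pose M : 'M[K]_(#|I|, n) := \matrix_(i, l) (G (enum_val i))`_l.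
have : kermx M != 0.
  rewrite -mxrank_eq0 mxrank_ker subn_eq0 -ltnNge.
  exact: leq_ltn_trans (rank_leq_col _) nI.
case/rowV0Pn => v /sub_kermxP vM v0.
exists (fun i => v ord0 (enum_rank i)).
  have [j vj] : exists j, v ord0 j != 0.
    apply/existsP; apply: contraNT v0; rewrite negb_exists => /forallP v0.
    by apply/eqP/rowP => j; rewrite mxE; apply/eqP; rewrite -[_ == _]negbK v0.
  by exists (enum_val j); rewrite enum_valK.
apply/polyP => l; rewrite coef0 coef_sum.
case: (ltnP l n) => [ln|nl]; last first.
  apply: big1 => i _; rewrite coefZ nth_default ?mulr0//.
  exact: leq_trans (sG i) nl.
have /rowP/(_ (Ordinal ln)) := vM; rewrite !mxE /=.
rewrite (reindex (@enum_rank I)) /=; last first.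
  by apply: onW_bij; exact: enum_rank_bij.
by under eq_bigr do rewrite mxE enum_rankK -coefZ.
Qed.

(* The summand of least weight [i * b + j * B] has strictly smaller order at 0
   than every other one. *)
Lemma stepanov_independent (K : fieldType) (d J b : nat) (u : {poly K})
    (k : 'I_d * 'I_J -> {poly K}) :
  u.[0] != 0 -> (forall p, (size (k p) <= b)%N) -> (exists p, k p != 0) ->
  \sum_p k p * ('X * u) ^+ (1 + p.1 * b) * 'X^(p.2 * (d * b).+1) != 0.
Proof.
move=> u0 sk [p0 kp0]; set B := (d * b).+1.
pose w (p : 'I_d * 'I_J) := (p.1 * b + p.2 * B)%N.
have [p kp pmin] := @arg_minnP _ p0 (fun p => k p != 0) w kp0.
have kE q : k q * ('X * u) ^+ (1 + q.1 * b) * 'X^(q.2 * B)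
  = 'X^(1 + w q) * (k q * u ^+ (1 + q.1 * b)).
  by rewrite exprMn /w addnA [in RHS]exprD mulrCA -mulrA [RHS]mulrA [in RHS]mulrAC mulrCA !mulrA.
apply/eqP => sum0; move: kp; apply/negP; rewrite negbK.
(* Since [i * b] stays below [d * b < B], every other weight exceeds that of [p] by at least [b].
   Cancellation would therefore force an extra factor ['X^b], which neither [k p], of size at most
   [b], nor a power of [u], nonzero at 0, can supply. *)
have dvd : 'X^(1 + w p) * 'X^b %|
    'X^(1 + w p) * (k p * u ^+ (1 + p.1 * b)).
  have := sum0; rewrite (bigD1 p)//= kE => /eqP; rewrite addr_eq0 => /eqP ->.
  rewrite dvdpNr; apply: (big_ind (fun z => _ %| z)) => [|x y|q qp].
  - exact: dvdp0.
  - exact: dvdp_add.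
  rewrite kE; have [->|kq] := eqVneq (k q) 0; first by rewrite mul0r mulr0 dvdp0.
  apply: dvdp_mulr; rewrite -exprD; apply: dvdp_exp2l.
  have := pmin q kq; move: qp; rewrite /w -addnA leq_add2l.
  case: p q {pmin kq} => [i j] [i' j'] /=; rewrite xpair_eqE negb_and.
  have := ltn_ord i; have := ltn_ord i'; rewrite /B.
  case: (ltngtP j j') => [jj|jj|/val_inj->] id' id.
  - move=> _ _.
    have : (i.+1 * b <= d * b)%N by rewrite leq_mul2r id orbT.
    have : (j.+1 * (d * b).+1 <= j' * (d * b).+1)%N by rewrite leq_mul2r jj orbT.
    rewrite mulSn; lia.
  - have : (i'.+1 * b <= d * b)%N by rewrite leq_mul2r id' orbT.
    have : (j'.+1 * (d * b).+1 <= j * (d * b).+1)%N by rewrite leq_mul2r jj orbT.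
    rewrite mulSn; lia.
  rewrite eqxx orbF => ii; have {}ii : (i != i' :> nat) by rewrite eq_sym.
  rewrite leq_add2r; case: (ltngtP i i') ii => // ii _ h.
  - have : (i.+1 * b <= i' * b)%N by rewrite leq_mul2r ii orbT.
    lia.
  have : (i'.+1 * b <= i * b)%N by rewrite leq_mul2r ii orbT.
  lia.
move: dvd; rewrite dvdp_mul2l ?expf_neq0 ?polyX_eq0// Gauss_dvdpl; last first.
  apply/coprimep_expl/coprimep_expr.
  by rewrite coprimep_sym coprimepX /root.
by move/(dvdp_leq _); case: eqP => //= _ /(_ isT); rewrite size_polyXn ltnNge sk.
Qed.

Lemma pchar_nat_expr_sum (K : comNzRingType) (n : nat) (I : finType) (F : I -> K) :
  [pchar K].-nat n -> (\sum_i F i) ^+ n = \sum_i F i ^+ n.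
Proof.
move=> Kn; apply: (big_morph (fun x => x ^+ n)).
  by move=> x y; exact: exprDn_pchar.
by rewrite expr0n; case: eqP Kn => // ->.
Qed.

Lemma pchar_nat_exprB (K : comNzRingType) (n : nat) (x y : K) :
  [pchar K].-nat n -> (x - y) ^+ n = x ^+ n - y ^+ n.
Proof.
by move=> Kn; rewrite -[x in RHS](subrK y) [X in _ = X - _]exprDn_pchar // addrK.
Qed.

Lemma pchar_nat_expr_inj (K : fieldType) (n : nat) :
  [pchar K].-nat n -> injective (fun x : K => x ^+ n).
Proof.
move=> Kn x y /eqP; rewrite -subr_eq0 -pchar_nat_exprB // expf_eq0 subr_eq0.
by case/andP => _ /eqP.
Qed.

(* Stepanov's method in Bombieri's form. With [B = sqrt Q] and [d = q - 1], the
   auxiliary polynomial R is chosen so that its B-th power, which on the points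
   counted equals a polynomial of small degree in x by [x ^+ Q = x] and
   [f.[x] ^+ c = zeta], vanishes there. No derivatives are needed, since the
   degree of R is already close to [Q / d]. *)
Lemma stepanov_bound (K : finFieldType) (d b : nat) (u : {poly K}) (zeta : K) :
  let B := (d * b).+1 in let c := (b * B.+1)%N in let mu := size u in
  [pchar K].-nat B -> (0 < d)%N -> (2 * mu + 6 < B)%N -> u.[0] != 0 ->
  (#|[set x : K | (x ^+ (B * B) == x) && (('X * u).[x] ^+ c == zeta)]|
     <= c + (2 * mu + 3) * B)%N.
Proof.
move=> B c mu KB d0 muB u0; set Z := [set x | _].
(* [R] has [d * J * b = (B - 1) * J] free coefficients, while each [G p] has size at most
   [b.-1 * B + mu * B + J]. This [J] makes the first number larger when [2 * mu + 6 < B], and still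
   keeps the degree of [R] below [c + (2 * mu + 3) * B]. *)
set f := 'X * u; pose J := (b + mu + 3)%N.
(* The B-th power of one monomial of [R], reduced on the counted points: [x ^+ (j * B * B)] becomes
   [x ^+ j], and [(1 + i * b) * B = c * i + (B - i * b)] turns the power of [f] into [zeta ^+ i]
   times a low power. *)
pose G (p : 'I_d * 'I_J * 'I_b) : {poly K} :=
  zeta ^+ p.1.1 *: ('X^(p.2 * B) * f ^+ (B - p.1.1 * b) * 'X^(p.1.2)).
have b0 : (0 < b)%N by case: (b) @B muB {J c G Z KB} => [|//]; rewrite muln0; lia.
have bB : (b < B)%N by rewrite ltnS leq_pmull.
have ibB (i : 'I_d) : (i * b <= B)%N.
  by apply: leqW; rewrite leq_mul2r ltnW ?ltn_ord ?orbT.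
have sf : (size f <= mu.+1)%N.
  by rewrite /f mulrC; have [->|un0] := eqVneq u 0; rewrite ?mul0r ?size_poly0 ?size_mulX.
have sfX n : (size (f ^+ n) <= (mu * n).+1)%N.
  apply: leq_trans (size_poly_exp_leq _ _) _; rewrite ltnS leq_mul2r.
  by apply/orP; right; lia.
have sG p : (size (G p) <= b.-1 * B + mu * B + J)%N.
  case: p => [[i j] t]; rewrite /G /=; apply: leq_trans (size_scale_leq _ _) _.
  apply: leq_trans (size_polyMleq _ _) _; rewrite size_polyXn addnS /=.
  have : (size ('X^(t * B) * f ^+ (B - i * b))%R <= (t * B + mu * B).+1)%N.
    apply: leq_trans (size_polyMleq _ _) _; rewrite size_polyXn addSn /=.
    apply: leq_trans (leq_add (leqnn _) (sfX _)) _.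
    by rewrite addnS ltnS leq_add2l leq_mul2l leq_subr orbT.
  have : (t * B <= b.-1 * B)%N.
    by rewrite leq_mul2r; apply/orP; right; rewrite -ltnS prednK.
  move=> tB /leq_add/(_ (leqnn j)) h; apply: leq_trans h _.
  by rewrite addSn -addnS leq_add ?leq_add2r.
have nI : (b.-1 * B + mu * B + J < #|{: 'I_d * 'I_J * 'I_b}|)%N.
  rewrite !card_prod !card_ord mulnAC.
  have -> : (d * b = B.-1)%N by [].
  rewrite /J; move: muB bB b0; clearbody B mu => muB bB b0; nia.
have [v [p0 vp0] vG] := polys_dependent sG nI.
(* Raising [R] to the power [B] also raises its coefficients, so these are the B-th roots of the
   solution [v]; they exist because an injective map of a finite field to itself is bijective. *)
pose w p := invF (pchar_nat_expr_inj KB) (v p).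
have wE p : w p ^+ B = v p by exact: (f_invF (pchar_nat_expr_inj KB)).
pose k (p : 'I_d * 'I_J) : {poly K} := \poly_(t < b) oapp (fun t => w (p, t)) 0 (insub t).
have sk p : (size (k p) <= b)%N by exact: size_poly.
have k0 : exists p, k p != 0.
  exists p0.1; apply: contraNneq vp0 => k0; rewrite -wE.
  have /polyP/(_ p0.2) := k0; rewrite coef_poly ltn_ord coef0 valK /= -surjective_pairing => ->.
  by rewrite expr0n.
have := stepanov_independent u0 sk k0; set R := \sum_p _ => R0.
have ZR : all (root R) (enum Z).
  apply/allP => x; rewrite mem_enum inE => /andP[/eqP xQ].
  rewrite -/f; set fx := f.[x] => /eqP fz.
  suff: R.[x] ^+ B = 0 by move/eqP; rewrite expf_eq0 => /andP[].
  have := congr1 (horner^~ x) vG; rewrite horner0 => <-.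
  rewrite /R !horner_sum (pchar_nat_expr_sum _ KB).
  transitivity (\sum_p \sum_t (v (p, t) *: G (p, t)).[x]); last first.
    by rewrite pair_bigA; apply: eq_bigr => -[].
  apply: eq_bigr => -[i j] _ /=.
  rewrite 2!hornerM horner_poly hornerXn horner_exp -/fx 2!exprMn (pchar_nat_expr_sum _ KB).
  rewrite -mulrA mulr_suml; apply: eq_bigr => t _.
  rewrite valK /= exprMn wE /G /= !hornerZ 2!hornerM !hornerXn.
  rewrite -[(x ^+ (j * B)) ^+ B]exprM -mulnA [(j * _)%N]mulnC exprM xQ.
  rewrite -[(x ^+ t) ^+ B]exprM -fz -!exprM -!mulrA; congr (_ * _).
  have -> : ((1 + i * b) * B = c * i + (B - i * b))%N.
    by rewrite /c; have := ibB i; move: (B) => B' h; nia.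
  by rewrite exprD horner_exp -/fx -!mulrA mulrCA.
have := max_poly_roots R0 ZR (enum_uniq _); rewrite -cardE ltnNge => h.
apply: leq_trans (_ : (size R).-1 <= _)%N; first by case: (size R) h => // n; rewrite -ltnNge.
have sR : (size R <= (b + (mu + mu * (d * b)) + (J.-1 * B)).+1)%N.
  apply: (big_ind (fun z : {poly K} => (size z <= _)%N)) => [|y z|[i j] _].
  - by rewrite size_poly0.
  - by move=> hy hz; apply: leq_trans (size_polyD _ _) _; rewrite geq_max hy.
  rewrite /=; apply: leq_trans (size_polyMleq _ _) _; rewrite size_polyXn addnS /=.
  have := size_polyMleq (k (i, j)) (f ^+ (1 + i * b)).
  have := sk (i, j); have := sfX (1 + i * b)%N.
  have : (i * b <= d * b)%N by rewrite leq_mul2r ltnW ?orbT.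
  move=> /(leq_mul (leqnn mu)).
  have : (j * B <= J.-1 * B)%N.
    by rewrite leq_mul2r; apply/orP; right; rewrite -ltnS prednK ?(ltn_ord j)// /J addn3.
  rewrite mulnDr muln1 -/B -/f.
  move: (size _) (size (f ^+ _)) (size (k _)) => s1 s2 s3.
  by move: (B) (mu) (j : nat) (J.-1) => B' mu' j' J'; lia.
have : (size R <= (c + (2 * mu + 3) * B).+1)%N.
  apply: leq_trans sR _; rewrite ltnS /J /c addnS /=.
  have -> : (d * b = B.-1)%N by [].
  by move: (B) bB => B' bB; nia.
by case: (size R).
Qed.

(** * Frobenius orbits over a finite field *)

Section RelativeFrobenius.
Variables (F K : finFieldType) (io : {rmorphism F -> K}).
Local Notation q := #|F|.

Lemma card_pchar_nat : [pchar K].-nat q.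
Proof.
have [p pp pF] := finPcharP F.
have /abelem_pgroup := fin_ring_pchar_abelem pF; rewrite /pgroup cardsT.
by rewrite (eq_pnat q (pcharf_eq (rmorph_pchar io pF))) => h; apply: h.
Qed.

Lemma card_pchar_natX n : [pchar K].-nat (q ^ n)%N.
Proof. by rewrite pnatX card_pchar_nat. Qed.

(** The [let] records the embedding [io], through which additivity is proved, so that the morphism
    instances can be found for [frobenius io] outside the section. *)
Definition frobenius (x : K) : K := let _ := io in x ^+ q.

Lemma frobenius_is_zmod_morphism : zmod_morphism frobenius.
Proof. by move=> x y; exact: pchar_nat_exprB card_pchar_nat. Qed.

Lemma frobenius_is_monoid_morphism : monoid_morphism frobenius.
Proof. by split => [|x y]; rewrite /frobenius ?expr1n ?exprMn. Qed.

HB.instance Definition _ :=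
  GRing.isZmodMorphism.Build K K frobenius frobenius_is_zmod_morphism.
HB.instance Definition _ :=
  GRing.isMonoidMorphism.Build K K frobenius frobenius_is_monoid_morphism.

Lemma iter_frobenius n x : iter n frobenius x = x ^+ (q ^ n).
Proof. by elim: n => [|n IHn] //=; rewrite IHn /frobenius -exprM expnSr. Qed.

Lemma frobenius_inj : injective frobenius.
Proof. exact: fmorph_inj. Qed.

Lemma frobenius_img a : frobenius (io a) = io a.
Proof. by rewrite /frobenius -rmorphXn expf_card. Qed.

Lemma frobenius_fixed x : frobenius x = x -> exists a, x = io a.
Proof.
move=> fx; have := congr1 (map_poly io) (finField_genPoly F).
rewrite rmorphB /= map_polyXn map_polyX map_prod_XsubC => e.
have : root ('X^q - 'X) x by rewrite /root !hornerE (fx : x ^+ q = x) subrr.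
rewrite e.
have -> : \prod_i ('X - (io i)%:P) = \prod_(z <- [seq io i | i : F]) ('X - z%:P).
  by rewrite big_image.
by rewrite root_prod_XsubC => /mapP[a _ ->]; exists a.
Qed.

Definition descend (x : K) : F := odflt 0 [pick a | io a == x].

Lemma io_descend x : frobenius x = x -> io (descend x) = x.
Proof.
move=> /frobenius_fixed[a ->]; rewrite /descend; case: pickP => [b /eqP//|].
by move/(_ a); rewrite eqxx.
Qed.

Lemma descend_io a : descend (io a) = a.
Proof. by apply: (fmorph_inj io); rewrite io_descend ?frobenius_img. Qed.

Lemma map_frobenius_img (g : {poly F}) :
  map_poly frobenius (map_poly io g) = map_poly io g.
Proof. by apply/polyP => i; rewrite !coef_map /= frobenius_img. Qed.

(** When the j-th iterate of Frobenius fixes x, this is the characteristic polynomial of x over the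
    field with [q ^ j] elements, a power of the minimal polynomial; its value at c is the norm of c
    - x. *)
Definition orbit_poly (x : K) (j : nat) : {poly K} :=
  \prod_(i < j) ('X - (iter i frobenius x)%:P).

Lemma map_frobenius_orbit_poly x j : iter j frobenius x = x ->
  map_poly frobenius (orbit_poly x j) = orbit_poly x j.
Proof.
case: j => [|j] xj; first by rewrite /orbit_poly !big_ord0 rmorph1.
rewrite /orbit_poly map_prod_XsubC big_ord_recr [in RHS]big_ord_recl /= mulrC.
by move: xj => /= ->; congr (_ * _); apply: eq_bigr.
Qed.

Definition orbit_polyF (x : K) (j : nat) : {poly F} :=
  map_poly descend (orbit_poly x j).

Lemma map_orbit_polyF x j : iter j frobenius x = x ->
  map_poly io (orbit_polyF x j) = orbit_poly x j.
Proof.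
move=> /map_frobenius_orbit_poly/polyP xj; apply/polyP => i.
rewrite coef_map /= coef_map_id0; last by rewrite -(rmorph0 io) descend_io.
by rewrite io_descend // -[in RHS]xj coef_map.
Qed.

Lemma size_orbit_poly x j : size (orbit_poly x j) = j.+1.
Proof.
by rewrite /orbit_poly size_prod_XsubC /index_enum -enumT size_enum_ord.
Qed.

Lemma orbit_polyF_monic x j : iter j frobenius x = x ->
  orbit_polyF x j \is monic.
Proof.
move=> xj; rewrite -(map_monic io) map_orbit_polyF //.
exact: monic_prod_XsubC.
Qed.

Lemma size_orbit_polyF x j : iter j frobenius x = x ->
  size (orbit_polyF x j) = j.+1.
Proof.
by move=> xj; rewrite -(size_map_poly io) map_orbit_polyF ?size_orbit_poly.
Qed.

Lemma iter_frobenius_eq x j :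
  (iter j frobenius x == x) = (fingraph.order frobenius x %| j)%N.
Proof.
set e := fingraph.order _ x; have e0 : (0 < e)%N by exact: fingraph.order_gt0.
have xe k : iter (k * e) frobenius x = x.
  by elim: k => //= k IHk; rewrite mulSn iterD IHk iter_order //; exact: frobenius_inj.
apply/eqP/idP => [xj|/dvdnP[k ->]]; last exact: xe.
move: xj; rewrite {1}(divn_eq j e) addnC iterD xe => xj.
have := @findex_iter _ frobenius x (j %% e) (ltn_pmod _ e0).
by rewrite xj findex0 /dvdn => <-.
Qed.

Lemma orbit_poly_pow x k : orbit_poly x (k * fingraph.order frobenius x) =
  (\prod_(y <- fingraph.orbit frobenius x) ('X - y%:P)) ^+ k.
Proof.
set e := fingraph.order _ x.
have pE : \prod_(y <- fingraph.orbit frobenius x) ('X - y%:P) = orbit_poly x e.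
  rewrite /fingraph.orbit -/e /orbit_poly; elim: (e) => [|n IHn].
    by rewrite big_nil big_ord0.
  by rewrite trajectSr big_rcons /= big_ord_recr /= IHn mulrC.
rewrite pE; elim: k => [|k IHk]; first by rewrite /orbit_poly big_ord0.
rewrite exprS -IHk mulSn /orbit_poly big_split_ord /=; congr (_ * _).
apply: eq_bigr => i _; rewrite addnC iterD iter_order //.
exact: frobenius_inj.
Qed.

(** Frobenius fixes the coefficients of [g] and carries a power of X - x dividing [g] to the same
    power of X - x ^ q. *)
Lemma mup_frobenius (g : {poly F}) (x : K) n : g != 0 ->
  (mup x (map_poly io g) <= mup (iter n frobenius x) (map_poly io g))%N.
Proof.
move=> g0; have G0 : map_poly io g != 0 by rewrite map_poly_eq0.
elim: n => [|n IHn]; first exact: leqnn.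
apply: leq_trans IHn _; rewrite iterS.
rewrite mup_geq // -{2}map_frobenius_img.
rewrite -[iter n _ x]/(iter n frobenius x) -map_polyXsubC -rmorphXn dvdp_map -mup_geq //.
Qed.

Lemma orbit_poly_dvdp (g : {poly F}) (x : K) k : g != 0 ->
  (orbit_poly x (k * fingraph.order frobenius x) %| map_poly io g)
    = (k <= mup x (map_poly io g))%N.
Proof.
move=> g0; have G0 : map_poly io g != 0 by rewrite map_poly_eq0.
rewrite orbit_poly_pow; apply/idP/idP => [|kx].
  rewrite mup_geq //; apply: dvdp_trans; apply: dvdp_exp2r.
  rewrite -[x in X in X %| _]/(iter 0 frobenius x).
  by rewrite dvdp_XsubCl root_prod_XsubC /= -?fingraph.in_orbit.
have : all (fun y => ('X - y%:P) ^+ k %| map_poly io g) (fingraph.orbit frobenius x).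
  apply/allP => y; rewrite -fconnect_orbit => /iter_findex <-.
  by rewrite -(mup_geq _ _ G0); exact: leq_trans kx (mup_frobenius _ _ g0).
elim: (fingraph.orbit _ x) (fingraph.orbit_uniq frobenius x) => [|y s IHs] /=.
  by rewrite big_nil expr1n dvd1p.
move=> /andP[ys us] /andP[yk sk]; rewrite big_cons exprMn Gauss_dvdp ?yk ?IHs //.
apply/coprimep_expl/coprimep_expr; rewrite coprimep_sym coprimep_XsubC.
by rewrite root_prod_XsubC.
Qed.

(* Every root of g of multiplicity mu is counted for exactly mu values of j,
   namely the first mu multiples of the size of its Frobenius orbit. *)
Lemma count_orbit_poly_dvdp (g : {poly F}) (rs : seq K) :
  map_poly io g = \prod_(z <- rs) ('X - z%:P) ->
  (\sum_(1 <= j < (size rs).+1) \sum_(x | iter j frobenius x == x)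
     (orbit_polyF x j %| g)%R = size rs)%N.
Proof.
move=> gE; have G0 : map_poly io g != 0.
  by rewrite gE monic_neq0 ?monic_prod_XsubC.
have g0 : g != 0 by move: G0; rewrite map_poly_eq0.
under eq_bigr do rewrite big_mkcond /=.
rewrite exchange_big /= (eq_bigr (fun x => count_mem x rs)); last first.
  move=> x _; set e := fingraph.order frobenius x; set mu := count_mem x rs.
  have e0 : (0 < e)%N by exact: fingraph.order_gt0.
  have muE : mup x (map_poly io g) = mu by rewrite gE mu_prod_XsubC.
  have xmu : (mu * e <= size rs)%N.
    rewrite -ltnS -(size_orbit_poly x) -(size_prod_XsubC rs id) -gE.
    by rewrite dvdp_leq // orbit_poly_dvdp // muE.
  transitivity (count (fun j => (e %| j) && (j %/ e <= mu))%N (index_iota 1 (size rs).+1)).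
    rewrite -sum1_count [RHS]big_mkcond /=.
    apply: eq_bigr => j _; rewrite iter_frobenius_eq -/e.
    case: ifP => //= ej; rewrite -(dvdp_map io) map_orbit_polyF; last first.
      by apply/eqP; rewrite iter_frobenius_eq.
    by rewrite -{1}(divnK ej) orbit_poly_dvdp // muE; case: ifP.
  rewrite -size_filter -[RHS](size_iota 1) -(size_map (muln^~ e) (iota 1 mu)).
  apply/perm_size/uniq_perm.
  - by apply: filter_uniq; exact: iota_uniq.
  - by rewrite map_inj_uniq ?iota_uniq // => a b /eqP; rewrite eqn_pmul2r // => /eqP.
  move=> j; rewrite mem_filter mem_index_iota; apply/idP/mapP.
    move=> /andP[/andP[ej jmu] /andP[j0 _]]; exists (j %/ e)%N; last by rewrite divnK.
    by rewrite mem_iota add1n ltnS jmu divn_gt0 // dvdn_leq.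
  move=> [k]; rewrite mem_iota add1n ltnS => /andP[k0 kmu] ->.
  rewrite dvdn_mull // mulnK // kmu muln_gt0 k0 e0 /= ltnS.
  by apply: leq_trans xmu; rewrite leq_mul2r kmu orbT.
elim: (rs) => [|z s IHs] /=; first by rewrite big1.
by rewrite big_split /= IHs (bigD1 z) //= eqxx big1 // => i /negbTE; rewrite eq_sym => ->.
Qed.

End RelativeFrobenius.

(** One finite field stands in for the algebraic closure: there are finitely many monic polynomials
    of bounded size, and the splitting field of their product is finite. *)
Lemma finField_split_monics (F : finFieldType) (D : nat) :
  exists (K : finFieldType) (io : {rmorphism F -> K}),
    forall g : {poly F}, g \is monic -> (size g <= D)%N ->
      exists rs : seq K, map_poly io g = \prod_(z <- rs) ('X - z%:P).
Proof.
pose p : {poly F} := \prod_(v : 'rV[F]_D | rVpoly v \is monic) rVpoly v.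
have p0 : p != 0 by apply/monic_neq0/monic_prod.
have [L [rs pE _]] := FinSplittingFieldFor p0.
exists (FinFieldExtType L), (GRing.in_alg L) => g gm sg.
have : map_poly (GRing.in_alg L) g %| \prod_(z <- rs) ('X - z%:P).
  rewrite -(eqp_dvdr _ pE) dvdp_map /p (bigD1 (poly_rV g)) ?poly_rV_K //=.
  exact: dvdp_mulr.
case/dvdp_prod_XsubC => m; rewrite eqp_monic ?monic_prod_XsubC ?map_monic //.
by move/eqP => mE; exists (mask m rs).
Qed.

(** * Monic polynomials and the Euler product *)

Definition monics (F : finFieldType) (n : nat) : seq {poly F} :=
  [seq 'X^n + rVpoly v | v : 'rV[F]_n].

Lemma mem_monics (F : finFieldType) n (g : {poly F}) :
  (g \in monics F n) = (g \is monic) && (size g == n.+1).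
Proof.
apply/mapP/andP => [[v _ ->]|[gm /eqP sg]].
  have sv : (size (rVpoly v) < size ('X^n : {poly F}))%N.
    by rewrite size_polyXn ltnS size_poly.
  by rewrite monicE lead_coefDl // lead_coefXn size_polyDl // size_polyXn.
exists (poly_rV (g - 'X^n)); first by rewrite mem_enum.
rewrite poly_rV_K ?subrKC //; apply/leq_sizeP => i; rewrite leq_eqVlt coefB coefXn.
case/orP => [/eqP <-|ni]; last first.
  by rewrite (gtn_eqF ni) subr0 nth_default // sg.
by move/monicP: gm; rewrite lead_coefE sg eqxx => ->; rewrite subrr.
Qed.

Lemma uniq_monics (F : finFieldType) n : uniq (monics F n).
Proof.
rewrite map_inj_uniq ?enum_uniq // => v w /addrI h.
by rewrite -[v]rVpolyK h rVpolyK.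
Qed.

Lemma big_monics_dvdp (F : finFieldType) (C : nmodType) (f : {poly F} -> C)
    (c : {poly F}) (n j : nat) :
  c \is monic -> size c = j.+1 -> (j <= n)%N ->
  \sum_(g <- monics F (n - j)) f (c * g) = \sum_(g <- monics F n | c %| g) f g.
Proof.
move=> cm sc jn; rewrite -(big_map (fun g => c * g) xpredT f) -[RHS]big_filter.
have c0 := monic_neq0 cm.
apply/perm_big/uniq_perm; rewrite ?filter_uniq ?uniq_monics //.
  by rewrite map_inj_uniq ?uniq_monics //; exact: mulfI.
move=> g; rewrite mem_filter mem_monics; apply/mapP/idP.
  move=> [h]; rewrite mem_monics => /andP[hm /eqP sh] ->.
  rewrite dvdp_mulr //= monicMl // hm size_mul ?monic_neq0 // sc sh.
  by rewrite addnS /= addSn subnKC.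
move=> /andP[/dvdpP[h ->]]; rewrite mulrC monicMl // => /andP[hm].
rewrite size_mul ?monic_neq0 // sc => /eqP sh; exists h => //.
by rewrite mem_monics hm -subSn // -sh addSn /= addKn eqxx.
Qed.

(* The logarithmic derivative of the Euler product of [sum_g lam g * T ^ deg g]:
   the sum over x is the n-th power sum attached to [lam], and closed points
   are replaced by Frobenius orbits. *)
Lemma Euler_product_recursion (F K : finFieldType) (io : {rmorphism F -> K})
    (C : comNzRingType) (lam : {poly F} -> C) (n : nat) :
  {morph lam : g h / g * h} ->
  (forall g : {poly F}, g \is monic -> (size g <= n.+1)%N ->
     exists rs : seq K, map_poly io g = \prod_(z <- rs) ('X - z%:P)) ->
  n%:R * \sum_(g <- monics F n) lam g =
  \sum_(1 <= j < n.+1)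
    (\sum_(x | iter j (frobenius io) x == x) lam (orbit_polyF io x j)) *
    \sum_(g <- monics F (n - j)) lam g.
Proof.
move=> lamM split; pose w j x (g : {poly F}) := orbit_polyF io x j %| g.
(* Expanded, the right-hand side weighs each [g] of degree [n] by the number of pairs (j, x) whose
   orbit polynomial divides it. That number is [n] by [count_orbit_poly_dvdp], whence the factor
   [n%:R]. *)
transitivity (\sum_(1 <= j < n.+1) \sum_(x | iter j (frobenius io) x == x)
    \sum_(g <- monics F n) lam g *+ w j x g); last first.
  apply: eq_big_nat => j /andP[j0 jn]; rewrite mulr_suml; apply: eq_bigr => x /eqP xj.
  rewrite mulr_sumr; under [RHS]eq_bigr do rewrite -lamM.
  rewrite big_monics_dvdp ?orbit_polyF_monic ?size_orbit_polyF //.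
  by rewrite [RHS]big_mkcond; apply: eq_bigr => g _; rewrite /w; case: (_ %| _).
under [RHS]eq_bigr do rewrite exchange_big /=.
rewrite [RHS]exchange_big /= mulr_sumr; apply: eq_big_seq => g.
rewrite mem_monics => /andP[gm /eqP sg].
have [rs gE] := split g gm (eq_leq sg).
have srs : size rs = n.
  by apply: succn_inj; rewrite -(size_prod_XsubC rs id) -gE size_map_poly sg.
have := count_orbit_poly_dvdp gE; rewrite srs => /(congr1 (fun k => k%:R : C)) <-.
rewrite natr_sum mulr_suml; apply: eq_bigr => j _.
by rewrite natr_sum mulr_suml; apply: eq_bigr => x _; rewrite mulr_natl.
Qed.

(** * Moduli and power sums *)

Section Modulus.
Variable R : rcfType.
Implicit Types z w : R[i].

(** The norm on [R[i]] is itself a complex number; its real part is taken so that estimates become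
    inequalities in [R]. *)
Definition modulus z : R := complex.Re `|z|.

Lemma modulusE z : (modulus z)%:C = `|z|.
Proof. by rewrite RRe_real ?normr_real. Qed.

Lemma modulus_ge0 z : 0 <= modulus z.
Proof. by rewrite -ler0c modulusE. Qed.

Lemma modulus0 : modulus 0 = 0.
Proof. by apply: complexI; rewrite modulusE normr0. Qed.

Lemma modulus1 : modulus 1 = 1.
Proof. by apply: complexI; rewrite modulusE normr1. Qed.

Lemma modulusN z : modulus (- z) = modulus z.
Proof. by rewrite /modulus normrN. Qed.

Lemma modulusM z w : modulus (z * w) = modulus z * modulus w.
Proof. by apply: complexI; rewrite rmorphM /= !modulusE normrM. Qed.

Lemma modulusX z n : modulus (z ^+ n) = modulus z ^+ n.
Proof. by apply: complexI; rewrite rmorphXn /= !modulusE normrX. Qed.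

Lemma modulus_prod (I : Type) (r : seq I) (P : pred I) (F : I -> R[i]) :
  modulus (\prod_(i <- r | P i) F i) = \prod_(i <- r | P i) modulus (F i).
Proof. exact: (big_morph modulus modulusM modulus1). Qed.

Lemma ler_modulusD z w : modulus (z + w) <= modulus z + modulus w.
Proof. by rewrite -lecR rmorphD /= !modulusE ler_normD. Qed.

Lemma ler_modulus_sum (I : Type) (r : seq I) (P : pred I) (F : I -> R[i]) :
  modulus (\sum_(i <- r | P i) F i) <= \sum_(i <- r | P i) modulus (F i).
Proof.
rewrite -lecR rmorph_sum /= modulusE; under [X in _ <= X]eq_bigr do rewrite modulusE.
exact: ler_norm_sum.
Qed.

Lemma modulus_conj z : modulus z^* = modulus z.
Proof. by apply: complexI; rewrite !modulusE normcJ. Qed.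

Lemma modulus_real (x : R) : modulus x%:C = `|x|.
Proof.
apply: complexI; rewrite modulusE normc_def /= expr0n /= addr0.
by rewrite sqrtr_sqr.
Qed.

Lemma modulus_nat n : modulus n%:R = n%:R.
Proof. by rewrite -[n%:R](rmorph_nat (real_complex R)) modulus_real normr_nat. Qed.

Lemma sqr_modulus z : (modulus z ^+ 2)%:C = z * z^*.
Proof. by rewrite -sqr_normc -modulusE rmorphXn. Qed.

Lemma modulus_eq0 z : (modulus z == 0) = (z == 0).
Proof. by rewrite -(inj_eq (@complexI R)) modulusE normr_eq0. Qed.

End Modulus.

Section PowerSums.

Lemma coef_prod_1subZX (C : comNzRingType) (w : C) (P : {poly C}) i :
  ((1 - w *: 'X) * P)`_i.+1 = P`_i.+1 - w * P`_i.
Proof. by rewrite mulrBl mul1r coefB -scalerAl coefZ coefXM. Qed.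

(** Newton's identities, that is the coefficients of X P' = - P * (sum over w of w X / (1 - w X)).
    In the induction on [s] the contribution of the new factor telescopes. *)
Lemma Newton_prod_1subZX (C : comNzRingType) (s : seq C) (n : nat) :
  let P := \prod_(w <- s) (1 - w *: 'X) in
  n%:R * P`_n = - \sum_(1 <= j < n.+1) (\sum_(w <- s) w ^+ j) * P`_(n - j).
Proof.
elim: s n => [|w s IHs] n P.
  rewrite /P big_nil coef1 big1 => [|j _]; last by rewrite big_nil mul0r.
  by case: n => [|n]; rewrite ?mul0r ?mulr0 oppr0.
rewrite /P big_cons {P}; set P := \prod_(j <- s) _ in IHs *.
case: n => [|n]; first by rewrite mul0r big_geq ?oppr0.
have P0 : ((1 - w *: 'X) * P)`_0 = P`_0.
  by rewrite mulrBl mul1r coefB -scalerAl coefZ coefXM mulr0 subr0.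
have IH := IHs n.+1; have IH' := IHs n.
rewrite big_add1 /= in IH *; rewrite coef_prod_1subZX mulrBr IH.
rewrite [X in _ = - X]big_nat_recr //= subnn P0.
have -> : \sum_(0 <= i < n) (\sum_(z <- w :: s) z ^+ i.+1) *
    ((1 - w *: 'X) * P)`_(n.+1 - i.+1) =
  \sum_(0 <= i < n) ((\sum_(z <- s) z ^+ i.+1) * P`_(n - i))
   - w * (\sum_(1 <= i < n.+1) ((\sum_(z <- s) z ^+ i) * P`_(n - i)))
   + \sum_(0 <= i < n) (w ^+ i.+1 * P`_(n - i) - w ^+ i.+2 * P`_(n - i.+1)).
  rewrite big_add1 mulr_sumr -sumrB -big_split /=.
  apply: eq_big_nat => i /andP[_ ni]; rewrite subSS big_cons.
  have -> : (n - i = (n - i.+1).+1)%N by lia.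
  rewrite coef_prod_1subZX !exprS; ring.
have tel : \sum_(0 <= i < n) (w ^+ i.+1 * P`_(n - i) - w ^+ i.+2 * P`_(n - i.+1))
   = w * P`_n - w ^+ n.+1 * P`_0.
  under eq_bigr do rewrite -opprB.
  rewrite sumrN (telescope_sumr (fun i => w ^+ i.+1 * P`_(n - i))) //.
  by rewrite subn0 subnn opprB expr1.
rewrite tel big_cons [X in - X - _]big_nat_recr //= subnn.
have -> : \sum_(1 <= i < n.+1) (\sum_(z <- s) z ^+ i) * P`_(n - i) = - (n%:R * P`_n).
  by rewrite IH' opprK.
rewrite -natr1 big_add1 /=; under eq_bigr do rewrite subSS; ring.
Qed.

(** As [L 0 = 1], the recursion can be solved for [S n]. Comparing the Euler product with Newton's
    identities in this way identifies character sums over extensions with power sums, up to the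
    degree [D] that a given splitting field can handle. *)
Lemma Newton_unique (C : comNzRingType) (L S T : nat -> C) (D : nat) :
  L 0%N = 1 ->
  (forall n, (n <= D)%N ->
     n%:R * L n = \sum_(1 <= j < n.+1) S j * L (n - j)%N) ->
  (forall n, (n <= D)%N ->
     n%:R * L n = \sum_(1 <= j < n.+1) T j * L (n - j)%N) ->
  forall n, (0 < n <= D)%N -> S n = T n.
Proof.
move=> L0 HS HT; elim/ltn_ind => -[//|n] IHn /andP[_ nD].
have := HS _ nD; rewrite HT // [X in X = _ -> _]big_nat_recr //= [X in _ = X -> _]big_nat_recr //=.
rewrite subnn L0 !mulr1.
rewrite (eq_big_nat _ _ (F2 := fun j => S j * L (n.+1 - j)%N)) => [/addrI->//|j].
by move=> /andP[j0 jn]; rewrite IHn // j0 (leq_trans (ltnW jn)).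
Qed.

Lemma bernoulli_expr (R : realDomainType) (x : R) n :
  0 <= x -> 1 + n%:R * x <= (1 + x) ^+ n.
Proof.
move=> x0; elim: n => [|n IHn]; first by rewrite mul0r addr0.
rewrite exprS; apply: le_trans (_ : (1 + x) * (1 + n%:R * x) <= _).
  rewrite -natr1; have : 0 <= n%:R * x * x by rewrite !mulr_ge0.
  lra.
by rewrite ler_wpM2l // addr_ge0.
Qed.

Lemma expr_bounded_le1 (R : archiRealFieldType) (x M : R) (n0 : nat) :
  0 <= x -> (forall n, (n0 <= n)%N -> x ^+ n <= M) -> x <= 1.
Proof.
move=> x0 xM; rewrite leNgt; apply/negP => x1.
have y0 : 0 < x - 1 by rewrite subr_gt0.
pose k := Num.bound (`|M| / (x - 1)).
have := xM _ (leq_addr k n0); apply/negP; rewrite -ltNge.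
have : `|M| / (x - 1) < k%:R by rewrite archi_boundP // divr_ge0 // ltW.
rewrite ltr_pdivrMr // => Mk; apply: le_lt_trans (ler_norm _) _.
apply: lt_le_trans (_ : 1 + (n0 + k)%:R * (x - 1) <= _); last first.
  by have := bernoulli_expr (n0 + k) (ltW y0); rewrite (addrC 1 (x - 1)) subrK.
rewrite natrD; have : 0 <= n0%:R * (x - 1) by rewrite mulr_ge0 // ltW.
lra.
Qed.

(* Applying to the power sums a polynomial vanishing at all the other terms
   isolates [count_mem w s * w ^+ n]. *)
Lemma power_sum_bound (R : realType) (s : seq R[i]) (A M : R) (n0 : nat) :
  0 < A ->
  (forall n, (n0 <= n)%N -> modulus (\sum_(w <- s) w ^+ n) <= M * A ^+ n) ->
  forall w, w \in s -> modulus w <= A.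
Proof.
move=> A0 sA w ws.
pose l := \prod_(z <- [seq z <- s | z != w]) ('X - z%:P).
have lw : l.[w] != 0.
  by rewrite -[_ == 0]/(root l w) root_prod_XsubC mem_filter eqxx.
have lE n : \sum_(t < size l) l`_t * (\sum_(z <- s) z ^+ (n + t)) =
    (count_mem w s)%:R * (w ^+ n * l.[w]).
  under eq_bigr do rewrite mulr_sumr.
  rewrite exchange_big /= (bigID (pred1 w)) /= [X in _ + X]big1_seq => [|z].
    rewrite addr0 -sum1_count natr_sum mulr_suml; apply: eq_bigr => z /eqP ->.
    rewrite mul1r horner_coef mulr_sumr; apply: eq_bigr => t _.
    by rewrite exprD mulrCA.
  move=> /andP[zw zs]; have /eqP : root l z.
    by rewrite root_prod_XsubC mem_filter zw.
  rewrite horner_coef => l0; transitivity (z ^+ n * \sum_(t < size l) l`_t * z ^+ t).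
    by rewrite mulr_sumr; apply: eq_bigr => t _; rewrite exprD mulrCA.
  by rewrite l0 mulr0.
pose m := modulus ((count_mem w s)%:R * l.[w]).
have m0 : 0 < m.
  rewrite lt0r modulus_ge0 modulus_eq0 mulf_neq0 // pnatr_eq0.
  by rewrite -lt0n -has_count has_pred1.
pose M1 := \sum_(t < size l) modulus l`_t * (M * A ^+ t).
suff : modulus w / A <= 1 by rewrite ler_pdivrMr // mul1r.
apply: (@expr_bounded_le1 _ _ (M1 / m) n0); first by rewrite divr_ge0 ?modulus_ge0 ?ltW.
move=> n nn0; rewrite ler_pdivlMr // expr_div_n mulrAC ler_pdivrMr ?exprn_gt0 //.
rewrite -modulusX -modulusM mulrCA -lE.
apply: le_trans (ler_modulus_sum _ _ _) _; rewrite mulr_suml; apply: ler_sum => t _.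
rewrite modulusM -mulrA ler_wpM2l ?modulus_ge0 //.
apply: le_trans (sA _ _) _; first exact: leq_trans nn0 (leq_addr _ _).
by rewrite exprD -mulrA [A ^+ t * _]mulrC.
Qed.

End PowerSums.

(** * The L-function *)

Section Weil.
Variables (R : realType) (F : finFieldType) (chi : F -> R[i]).
Hypotheses (chiM : monoid_morphism chi) (chi0 : chi 0 = 0).
Local Notation q := #|F|.

Lemma charX x n : chi (x ^+ n) = chi x ^+ n.
Proof.
by case: chiM => c1 cM; elim: n => [|n IHn]; rewrite ?expr0 // !exprS cM IHn.
Qed.

Lemma char_prod (I : Type) (r : seq I) (P : pred I) (f : I -> F) :
  chi (\prod_(i <- r | P i) f i) = \prod_(i <- r | P i) chi (f i).
Proof. by case: chiM => c1 cM; exact: (big_morph chi cM c1). Qed.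

Lemma char_expr_card_pred x : x != 0 -> chi x ^+ q.-1 = 1.
Proof.
move=> x0; rewrite -charX; case: chiM => c1 _; rewrite -c1; congr chi.
by apply: (mulfI x0); rewrite -exprS prednK ?expf_card ?mulr1 // ltnW ?finNzRing_gt1.
Qed.

Lemma modulus_char x : x != 0 -> modulus (chi x) = 1.
Proof.
move=> /char_expr_card_pred /(congr1 (@modulus R)); rewrite modulusX modulus1.
have q1 := finNzRing_gt1 F.
by move/eqP; rewrite pexpr_eq1 ?modulus_ge0 ?ltn_predRL // => /eqP.
Qed.

Lemma modulus_char_le1 x : modulus (chi x) <= 1.
Proof.
by have [->|/modulus_char->//] := eqVneq x 0; rewrite chi0 modulus0.
Qed.

(** For nonzero x the exponent [q.-2] already gives the inverse; the additional [q.-1] keeps the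
    exponent positive when the field has two elements, so that the identity also holds at 0. *)
Lemma conj_char x : (chi x)^* = chi x ^+ (q.-2 + q.-1).
Proof.
have q1 := finNzRing_gt1 F.
have [->|x0] := eqVneq x 0.
  rewrite chi0 conjc0 expr0n; case: eqP => // /eqP.
  by rewrite addn_eq0 => /andP[_]; case: (q) q1 => [|[]].
have cx : chi x != 0 by rewrite -modulus_eq0 modulus_char ?oner_eq0.
rewrite exprD char_expr_card_pred // mulr1; apply: (mulfI cx).
rewrite -sqr_modulus modulus_char // expr1n rmorph1 -exprS.
by rewrite prednK ?char_expr_card_pred //; case: (q) q1 => [|[]].
Qed.

Hypothesis chi_nonprincipal : exists2 x, x != 0 & chi x != 1.

Lemma sum_char : \sum_x chi x = 0.
Proof.
case: chi_nonprincipal => x x0 cx; case: chiM => c1 cM.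
have /eqP : (1 - chi x) * \sum_y chi y = 0.
  rewrite mulrBl mul1r mulr_sumr; apply/eqP; rewrite subr_eq0; apply/eqP.
  under [RHS]eq_bigr do rewrite -cM.
  rewrite (reindex_inj (mulfI x0)) //.
by rewrite mulf_eq0 subr_eq0 eq_sym (negbTE cx) => /eqP.
Qed.

Variables (I : finType) (a : I -> F) (e : I -> nat) (i0 : I).
Hypothesis e_i0 : e i0 = 1%N.
Hypothesis a_i0 : forall i, i != i0 -> a i != a i0.

(** A Dirichlet character on [{poly F}]: multiplicative, with values depending only on [g] modulo
    the product of the X - a i. [Lcoef] lists the coefficients of its L-function. *)
Definition char_of_poly (g : {poly F}) : R[i] := \prod_i chi g.[a i] ^+ e i.

Lemma char_of_polyM : {morph char_of_poly : g h / g * h}.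
Proof.
case: chiM => _ cM g h; rewrite /char_of_poly -big_split /=.
by apply: eq_bigr => i _; rewrite hornerM cM exprMn.
Qed.

Definition Lcoef n : R[i] := \sum_(g <- monics F n) char_of_poly g.

Lemma Lcoef0 : Lcoef 0 = 1.
Proof.
rewrite /Lcoef (perm_big [:: 1]) /=.
  rewrite big_seq1 /char_of_poly big1 // => i _.
  by case: chiM => c1 _; rewrite hornerE c1 expr1n.
apply: uniq_perm; rewrite ?uniq_monics // => g; rewrite mem_monics inE.
apply/andP/eqP => [[gm /eqP/eq_leq/size1_polyC gE]|->].
  by move: gm; rewrite gE monicE lead_coefC => /eqP ->.
by rewrite monic1 size_poly1.
Qed.

(** Only the value at [a i0] has to vary. The polynomial [h] vanishes at all other points and has
    degree below [n], so adding multiples of [h] permutes the monics of degree [n] while the value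
    at [a i0] runs over [F]. As [e i0 = 1], averaging produces the complete sum of [chi], which is
    0. The other points may coincide with one another. *)
Lemma Lcoef_eq0 n : (#|I| <= n)%N -> Lcoef n = 0.
Proof.
move=> In; pose h := \prod_(i | i != i0) ('X - (a i)%:P).
have h0 : h.[a i0] != 0.
  rewrite horner_prod; apply/prodf_neq0 => i ii; rewrite hornerXsubC subr_eq0.
  by rewrite eq_sym a_i0.
have hi i : i != i0 -> h.[a i] = 0.
  by move=> ii; rewrite horner_prod (bigD1 i) //= hornerXsubC subrr mul0r.
have sh : (size h <= n)%N.
  rewrite /h -big_filter size_prod_XsubC; apply: leq_trans In.
  rewrite size_filter cardE -(count_predC (pred1 i0)) /index_enum -enumT.
  rewrite -add1n leq_add //.
  by rewrite -has_count; apply/hasP; exists i0; rewrite ?mem_enum /=.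
have shift t : Lcoef n = \sum_(g <- monics F n) char_of_poly (g + t *: h).
  rewrite -(big_map (fun g => g + t *: h) xpredT) /Lcoef; apply: perm_big.
  apply: uniq_perm; rewrite ?uniq_monics //.
    by rewrite map_inj_uniq ?uniq_monics // => x y /addIr.
  have mon (u : F) g : g \in monics F n -> g + u *: h \in monics F n.
    rewrite !mem_monics => /andP[gm /eqP sg].
    have su : (size (u *: h) < size g)%N.
      by rewrite sg ltnS; apply: leq_trans (size_scale_leq _ _) sh.
    by rewrite monicE lead_coefDl // size_polyDl // sg eqxx andbT -monicE.
  move=> g; apply/idP/mapP => [gM|[g' gM ->]]; last exact: mon.
  by exists (g + (- t) *: h); rewrite ?mon // scaleNr subrK.
have /eqP : (q%:R : R[i]) * Lcoef n = 0.
  rewrite mulr_natl -sumr_const; under eq_bigr => t _ do rewrite (shift t).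
  rewrite exchange_big /=.
  apply: big1 => g _; rewrite /char_of_poly.
  under eq_bigr do rewrite (bigD1 i0) //= e_i0 expr1 hornerD hornerZ.
  have E t : \prod_(i | i != i0) chi (g + t *: h).[a i] ^+ e i =
             \prod_(i | i != i0) chi g.[a i] ^+ e i.
    by apply: eq_bigr => i ii; rewrite hornerD hornerZ hi // mulr0 addr0.
  under eq_bigr do rewrite E.
  rewrite -mulr_suml; suff -> : \sum_t chi (g.[a i0] + t * h.[a i0]) = 0 by rewrite mul0r.
  have inj : injective (fun t => g.[a i0] + t * h.[a i0]).
    by move=> s t /addrI /(mulIf h0).
  by transitivity (\sum_x chi x); [rewrite [RHS](reindex_inj inj)|exact: sum_char].
by rewrite mulf_eq0 pnatr_eq0 (gtn_eqF (ltnW (finNzRing_gt1 F))) => /eqP.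
Qed.

Section Extension.
Variables (K : finFieldType) (io : {rmorphism F -> K}).

(** The analogous character sum over the subfield fixed by the j-th iterate of Frobenius, with [chi]
    composed with the norm. *)
Definition orbit_char_sum j : R[i] :=
  \sum_(x | iter j (frobenius io) x == x) char_of_poly (orbit_polyF io x j).

Lemma orbit_char_sum1 : orbit_char_sum 1 = \sum_y \prod_i chi (a i - y) ^+ e i.
Proof.
rewrite /orbit_char_sum (reindex_onto io (descend io)) /=; last first.
  by move=> x /eqP; exact: io_descend.
apply: eq_big => [y|y _]; first by rewrite frobenius_img descend_io !eqxx.
apply: eq_bigr => i _; congr (chi _ ^+ _); apply: (fmorph_inj io).
rewrite -horner_map map_orbit_polyF /=; last by rewrite frobenius_img.
by rewrite /orbit_poly big_ord1 hornerXsubC rmorphB.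
Qed.

Lemma horner_orbit_polyF x j c : iter j (frobenius io) x = x ->
  io (orbit_polyF io x j).[c] = (io c - x) ^+ (\sum_(i < j) q ^ i).
Proof.
move=> xj; rewrite -horner_map map_orbit_polyF // /orbit_poly horner_prod.
rewrite (big_morph (fun n => (io c - x) ^+ n) (exprD _) (expr0 _)).
apply: eq_bigr => i _; rewrite hornerXsubC iter_frobenius.
rewrite (pchar_nat_exprB _ _ (card_pchar_natX io _)); congr (_ - _).
by rewrite -(iter_frobenius io) iter_fix ?frobenius_img.
Qed.

Lemma card_frobenius_fixed j : (0 < j)%N ->
  (forall g : {poly F}, g \is monic -> (size g <= (q ^ j).+1)%N ->
     exists rs : seq K, map_poly io g = \prod_(z <- rs) ('X - z%:P)) ->
  #|[set x | iter j (frobenius io) x == x]| = (q ^ j)%N.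
Proof.
move=> j0 split; have q1 := finNzRing_gt1 F.
have qj : (1 < q ^ j)%N by rewrite -[1%N](exp1n j) ltn_exp2r.
pose g : {poly F} := 'X^(q ^ j) - 'X.
have sX : (size (- 'X : {poly F}) < size ('X^(q ^ j) : {poly F}))%N.
  by rewrite size_polyN size_polyX size_polyXn.
have gm : g \is monic by rewrite monicE lead_coefDl // lead_coefXn.
have sg : size g = (q ^ j).+1 by rewrite size_polyDl // size_polyXn.
have [rs gE] := split g gm (eq_leq sg).
have gK : map_poly io g = 'X^(q ^ j) - 'X.
  by rewrite rmorphB /= map_polyXn map_polyX.
have urs : uniq rs.
  rewrite -separable_prod_XsubC -gE gK separable_poly.unlock derivB derivXn derivX.
  have -> : ('X : {poly K}) ^+ (q ^ j).-1 *+ (q ^ j) = 0.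
    rewrite -mulr_natl -polyC_natr; suff -> : (q ^ j)%:R = 0 :> K by rewrite polyC0 mul0r.
    rewrite natrX; suff -> : q%:R = 0 :> K by rewrite expr0n (gtn_eqF j0).
    rewrite -(rmorph_nat io); suff -> : q%:R = 0 :> F by rewrite rmorph0.
    apply: (@addrI _ (\sum_(x : F) x)); rewrite addr0 -sumr_const -big_split /=.
    by rewrite [RHS](reindex_inj (addIr 1)).
    by rewrite sub0r -[X in coprimep _ X]scaleN1r coprimepZr ?oppr_eq0 ?oner_eq0 // coprimep1.
have <- : size rs = (q ^ j)%N.
  by apply: succn_inj; rewrite -(size_prod_XsubC rs id) -gE size_map_poly sg.
rewrite -(card_uniqP urs); apply: eq_card => x; rewrite inE -root_prod_XsubC -gE gK.
by rewrite /root !hornerE subr_eq0 iter_frobenius.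
Qed.

End Extension.
End Weil.

(** * Bounds over extension fields and Weil's bound *)

Lemma size_prod_exp_leq (K : idomainType) (I : finType) (P : pred I)
    (p : I -> {poly K}) (e : I -> nat) :
  (forall i, (size (p i) <= 2)%N) ->
  (size (\prod_(i | P i) p i ^+ e i)%R <= (\sum_i e i).+1)%N.
Proof.
move=> sp; apply: (@leq_trans (\sum_(i | P i) e i).+1); last first.
  by rewrite ltnS [leqRHS](bigID P) leq_addr.
apply: (big_ind2 (fun (x : {poly K}) n => (size x <= n.+1)%N)).
- by rewrite size_poly1.
- move=> x n y m xn ym; apply: leq_trans (size_polyMleq _ _) _.
  by move: (size x) (size y) xn ym => sx sy; lia.
move=> i _; apply: leq_trans (size_poly_exp_leq _ _) _.
by rewrite ltnS -[leqRHS]mul1n leq_mul2r -subn1 leq_subLR addn1 sp orbT.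
Qed.

(** Stepanov's method bounds the number [N z] of points with character argument [z] only from above,
    by [M]. Since [chi] sums to 0, [N z] may be replaced by the defect [M - N z], which is
    nonnegative; since all [N z] add up to [q ^ (2 * m)], the total defect over nonzero [z] is of
    order [q ^ m]. *)
Lemma orbit_char_sum_even_bound (R : realType) (F K : finFieldType)
    (io : {rmorphism F -> K}) (chi : F -> R[i]) (I : finType) (a : I -> F)
    (e : I -> nat) (i0 : I) (m : nat) :
  let q := #|F| in let mu := (\sum_i e i).+1 in
  monoid_morphism chi -> chi 0 = 0 -> (exists2 x, x != 0 & chi x != 1) ->
  a i0 = 0 -> e i0 = 1%N ->
  (forall i, i != i0 -> a i != 0) ->
  (forall g : {poly F}, g \is monic -> (size g <= (q ^ (2 * m)).+1)%N ->
     exists rs : seq K, map_poly io g = \prod_(z <- rs) ('X - z%:P)) ->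
  (2 * mu + 6 < q ^ m)%N ->
  modulus (orbit_char_sum chi a e io (2 * m)) <= (q * (3 * mu + 3) * q ^ m)%:R.
Proof.
move=> q mu chiM chi0 chi1 a0 e0 a_neq0 split muB.
have q1 : (1 < q)%N := finNzRing_gt1 F.
have m0 : (0 < m)%N by case: (m) muB => //; rewrite expn0; lia.
pose d := q.-1; pose b := (\sum_(i < m) q ^ i)%N.
have d0 : (0 < d)%N by rewrite ltn_predRL.
have BE : (q ^ m = (d * b).+1)%N.
  by rewrite /d /b -predn_exp prednK // expn_gt0 ltnW.
pose c := (\sum_(i < 2 * m) q ^ i)%N.
have cE : c = (b * (d * b).+2)%N.
  apply/eqP; rewrite -(eqn_pmul2l d0) /c /d -predn_exp -/d mulnC expnM mulnC.
  rewrite BE; apply/eqP; move: (d) => d'; nia.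
have QE : (q ^ (2 * m) = (d * c).+1)%N.
  by rewrite /d /c -predn_exp prednK // expn_gt0 ltnW.
(* The factor of index [i0] is [- 'X], whence the sign. The c-th power of ['X * u] is the product of
   the norms, and the zero at 0 is simple as [stepanov_bound] requires. *)
pose u : {poly K} := - \prod_(i | i != i0) ((io (a i))%:P - 'X) ^+ e i.
have s2 i : (size ((io (a i))%:P - 'X)%R <= 2)%N.
  by rewrite -opprB size_polyN size_XsubC.
have u0 : u.[0] != 0.
  rewrite hornerN oppr_eq0 horner_prod; apply/prodf_neq0 => i ii.
  by rewrite horner_exp !hornerE subr0 expf_neq0 // fmorph_eq0 a_neq0.
have su : (size u <= mu)%N by rewrite size_polyN size_prod_exp_leq.
have fE x : ('X * u).[x] = \prod_i (io (a i) - x) ^+ e i.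
  rewrite [RHS](bigD1 i0) //= a0 e0 rmorph0 sub0r expr1 hornerM hornerX hornerN.
  rewrite mulrN mulNr horner_prod; congr (- (_ * _)).
  by apply: eq_bigr => i _; rewrite horner_exp !hornerE.
pose T x := \prod_i (orbit_polyF io x (2 * m)).[a i] ^+ e i.
have TE x : iter (2 * m) (frobenius io) x == x -> io (T x) = ('X * u).[x] ^+ c.
  move/eqP => fx; rewrite fE rmorph_prod /= -prodrXl; apply: eq_bigr => i _.
  by rewrite rmorphXn /= horner_orbit_polyF // exprAC.
pose N z := #|[set x : K | (iter (2 * m) (frobenius io) x == x) && (T x == z)]|.
pose M := (c + (2 * mu + 3) * q ^ m)%N.
have KB : [pchar K].-nat (d * b).+1 by rewrite -BE; exact: card_pchar_natX.
have NM z : (N z <= M)%N.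
  have muB' : (2 * size u + 6 < (d * b).+1)%N by rewrite -BE; lia.
  have := @stepanov_bound K d b u (io z) KB d0 muB' u0.
  rewrite -cE -BE => h; apply: leq_trans (_ : c + (2 * size u + 3) * q ^ m <= _)%N.
    apply: leq_trans h; apply/subset_leq_card/fintype.subsetP => x; rewrite !inE.
    move=> /andP[fx /eqP <-]; rewrite -TE // eqxx andbT -expnD addnn -mul2n.
    by rewrite -(iter_frobenius io).
  rewrite leq_add2l leq_mul2r leq_add2r leq_mul2l su !orbT //.
have NS : (\sum_z N z = (d * c).+1)%N.
  rewrite -QE -(card_frobenius_fixed _ split) ?muln_gt0 //.
  rewrite cardsE -sum1_card (partition_big T xpredT) //=.
  by apply: eq_bigr => z _; rewrite /N cardsE -sum1_card; apply: eq_bigl.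
have N0 : (N 0%R <= mu)%N.
  have U0 : 'X * u != 0.
    by rewrite mulf_neq0 ?polyX_eq0 //; apply: contraNneq u0 => ->; rewrite horner0.
  have rt : all (root ('X * u)) (enum [set x : K | (iter (2 * m) (frobenius io) x == x) && (T x == 0)]).
    apply/allP => x; rewrite mem_enum inE => /andP[fx /eqP T0].
    have := TE x fx; rewrite T0 rmorph0 => /esym/eqP.
    by rewrite expf_eq0 => /andP[].
  have := max_poly_roots U0 rt (enum_uniq _); rewrite -cardE -/(N 0).
  move/leq_trans => h; rewrite -ltnS; apply: h; apply: leq_trans (size_polyMleq _ _) _.
  by rewrite size_polyX add2n /= ltnS.
have SE : orbit_char_sum chi a e io (2 * m) = - \sum_(z | z != 0) chi z * (M - N z)%:R.
  transitivity (\sum_z chi z * (N z)%:R).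
    rewrite /orbit_char_sum (partition_big T xpredT) //=; apply: eq_bigr => z _.
    transitivity (\sum_(i | (iter (2 * m) (frobenius io) i == i) && (T i == z)) chi z).
      apply: eq_bigr => x /andP[_ /eqP <-]; rewrite /char_of_poly /T char_prod //.
      by apply: eq_bigr => i _; rewrite charX.
    by rewrite sumr_const mulr_natr /N cardsE.
  have : \sum_z chi z * (M%:R : R[i]) = 0 by rewrite -mulr_suml sum_char ?mul0r.
  move/(congr1 (fun t => \sum_z chi z * (N z)%:R - t)); rewrite subr0 => <-.
  rewrite -sumrB (bigD1 0) //= chi0 !mul0r subr0 add0r -sumrN; apply: eq_bigr => z _.
  by rewrite natrB // mulrBr opprB.
rewrite SE modulusN; apply: le_trans (ler_modulus_sum _ _ _) _.
apply: le_trans (_ : (\sum_(z | z != 0%R) (M - N z))%:R <= _).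
  rewrite natr_sum; apply: ler_sum => z z0.
  by rewrite modulusM modulus_char // mul1r modulus_nat.
rewrite ler_nat.
have : (\sum_(z | z != 0%R) (M - N z) + \sum_(z | z != 0%R) N z = d * M)%N.
  rewrite -big_split /= (eq_bigr (fun _ => M)) => [|z _]; last by rewrite subnK.
  rewrite sum_nat_const; congr (_ * _)%N; rewrite /d /q -(cardC1 (0 : F)).
  by apply: eq_card => z; rewrite !inE.
have := NS; rewrite (bigD1 0) //=.
rewrite /M mulnDr; move: N0 muB d0; have -> : q = d.+1 by rewrite /d prednK // ltnW.
move: (\sum_(z | z != 0%R) (M - N z))%N (\sum_(z | z != 0%R) N z)%N (d * c)%N => s1 s2' s3.
move: (N 0) (d) (mu) (d.+1 ^ m)%N => n0 d' mu' B; nia.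
Qed.

Lemma prod_1subZX_of_poly (C : closedFieldType) (P : {poly C}) : P`_0 = 1 ->
  exists2 s : seq C, P = \prod_(w <- s) (1 - w *: 'X) & size P = (size s).+1.
Proof.
move=> P0; have [r rE] := closed_field_poly_normal P.
have lP : lead_coef P != 0.
  by rewrite lead_coef_eq0; apply: contraTneq (oner_neq0 C) => PE; rewrite -P0 PE coef0 eqxx.
have P00 : P.[0] = 1 by rewrite horner_coef0.
have r0 z : z \in r -> z != 0.
  move=> zr; apply: contraTneq (oner_neq0 C) => z0; rewrite -P00 negbK rE hornerZ.
  have /eqP -> : root (\prod_(z <- r) ('X - z%:P)) 0 by rewrite root_prod_XsubC -z0.
  by rewrite mulr0.
exists (map (fun z => z^-1) r); last first.
  by rewrite size_map rE size_scale // size_prod_XsubC.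
set p := \prod_(w <- _) _.
have [k kE] : exists k, P = k *: p.
  rewrite rE /p {rE P0 lP P00 p}; exists (lead_coef P * \prod_(z <- r) (- z)).
  rewrite -scalerA; congr (_ *: _); elim: r r0 => [|z r IHr] r0.
    by rewrite !big_nil scale1r.
  rewrite !big_cons IHr => [|y yr]; last by rewrite r0 // inE yr orbT.
  rewrite -scalerAr [- z * _]mulrC -scalerA; congr (_ *: _).
  rewrite scalerAl; congr (_ * _); rewrite scalerBr scalerA mulNr.
  by rewrite divff ?r0 ?inE ?eqxx // scaleN1r opprK scaleNr alg_polyC addrC.
suff k1 : k = 1 by rewrite kE k1 scale1r.
have p0 : p.[0] = 1.
  by rewrite horner_prod big1 // => w _; rewrite !hornerE ?mulr0 subr0.
by move: P00; rewrite kE hornerZ p0 mulr1.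
Qed.

(** The reciprocal roots [s] come from [Lcoef], which involves [F] alone, so a new field [K] may be
    chosen for every [m]. Sums of order [2 * m] are power sums of the squares of the roots and are
    bounded by a constant times [q ^ m]; hence each [w ^+ 2] has modulus at most [q]. The wanted sum
    is, up to sign, the first power sum, with at most [#|I|] terms. *)
Lemma Weil_bound0 (R : realType) (F : finFieldType) (chi : F -> R[i])
    (I : finType) (a : I -> F) (e : I -> nat) (i0 : I) :
  monoid_morphism chi -> chi 0 = 0 -> (exists2 x, x != 0 & chi x != 1) ->
  a i0 = 0 -> e i0 = 1%N ->
  (forall i, i != i0 -> a i != 0) ->
  modulus (\sum_y \prod_i chi (a i - y) ^+ e i) <= #|I|%:R * Num.sqrt #|F|%:R.
Proof.
move=> chiM chi0 chi1 a0 e0 a_neq0; set q := #|F|.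
have q1 : (1 < q)%N := finNzRing_gt1 F.
have q_gt0 : 0 < q%:R :> R by rewrite ltr0n ltnW.
pose L := Lcoef chi a e; pose P := \poly_(n < #|I|) L n.
have PL n : P`_n = L n.
  rewrite coef_poly; case: ltnP => // nI; rewrite /L (@Lcoef_eq0 _ _ _ chiM chi1 _ _ _ i0) //.
  by move=> i ii; rewrite a0 a_neq0.
have P0 : P`_0 = 1 by rewrite PL; exact: Lcoef0.
have [s PE sP] := prod_1subZX_of_poly P0.
have ss : (size s <= #|I|)%N by apply/ltnW; rewrite -sP size_poly.
pose mu := (\sum_i e i).+1.
have sumE (m : nat) (K : finFieldType) (io : {rmorphism F -> K}) :
    (forall g : {poly F}, g \is monic -> (size g <= m.+1)%N ->
       exists rs : seq K, map_poly io g = \prod_(z <- rs) ('X - z%:P)) ->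
    forall n, (0 < n <= m)%N ->
      orbit_char_sum chi a e io n = - \sum_(w <- s) w ^+ n.
  move=> split; apply: (@Newton_unique _ L _ (fun n => - \sum_(w <- s) w ^+ n)).
  - exact: Lcoef0.
  - move=> n nm; apply: Euler_product_recursion; first exact: char_of_polyM.
    by move=> g gm sg; apply: split => //; apply: leq_trans sg _.
  move=> n nm; rewrite -PL PE Newton_prod_1subZX -sumrN; apply: eq_bigr => j _.
  by rewrite mulNr -PE PL.
have bound m : (2 * mu + 6 <= m)%N ->
    modulus (\sum_(w <- [seq w ^+ 2 | w <- s]) w ^+ m)
      <= (q * (3 * mu + 3))%:R * q%:R ^+ m.
  move=> mum; have m0 : (0 < m)%N by apply: leq_trans mum; rewrite addnS.
  have mB : (m < q ^ m)%N by exact: ltn_expl.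
  have [K [io split]] := finField_split_monics F (q ^ (2 * m)).+1.
  rewrite big_map; under eq_bigr do rewrite -exprM.
  have m2 : (0 < 2 * m <= q ^ (2 * m))%N by rewrite muln_gt0 m0 /=; apply/ltnW/ltn_expl.
  rewrite -modulusN -(sumE _ _ _ split) //.
  rewrite -natrX -natrM; apply: (@orbit_char_sum_even_bound _ _ _ _ _ _ _ _ i0) => //.
  exact: leq_ltn_trans mum mB.
have ws w : w \in s -> modulus w <= Num.sqrt q%:R.
  move=> ws; have w2 : w ^+ 2 \in [seq w ^+ 2 | w <- s] by apply/mapP; exists w.
  have := power_sum_bound q_gt0 bound w2; rewrite modulusX => h.
  by rewrite -(ler_pXn2r (n := 2)) ?nnegrE ?modulus_ge0 ?sqrtr_ge0 // sqr_sqrtr // ltW.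
have [K [io split]] := finField_split_monics F 2.
rewrite -(orbit_char_sum1 chi a e io) (sumE _ _ _ split) // modulusN.
under eq_bigr do rewrite expr1.
apply: le_trans (ler_modulus_sum _ _ _) _.
apply: (@le_trans _ _ (\sum_(w <- s) Num.sqrt (q%:R : R))).
  by rewrite big_seq [leRHS]big_seq; apply: ler_sum.
rewrite big_const_seq count_predT iter_addr_0 -[_ *+ size s]mulr_natl ler_wpM2r ?sqrtr_ge0 //.
by rewrite ler_nat.
Qed.

(** Conjugates of [chi] are powers of [chi] and conversely, so all factors are powers of one
    character [psi], taken to be [chi] or its conjugate according to [s i0]. The isolated factor
    then has exponent 1, and the substitution x = - y - b i0 moves its point to 0. *)
Lemma Weil_bound (R : realType) (F : finFieldType) (chi : F -> R[i])
    (I : finType) (b : I -> F) (s : pred I) (i0 : I) :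
  monoid_morphism chi -> chi 0 = 0 -> (exists2 x, x != 0 & chi x != 1) ->
  (forall i, i != i0 -> b i != b i0) ->
  modulus (\sum_x \prod_i (if s i then chi (x + b i) else (chi (x + b i))^*))
    <= #|I|%:R * Num.sqrt #|F|%:R.
Proof.
move=> chiM chi0 chi1 b0; set q := #|F|.
pose n := (q.-2 + q.-1)%N.
pose e i := if s i == s i0 then 1%N else n.
have [c1 cM] := chiM.
pose psi x := if s i0 then chi x else (chi x)^*.
have psiM : monoid_morphism psi.
  rewrite /psi; split => [|x y]; rewrite ?c1 ?cM ?rmorph1 ?rmorphM; by case: ifP.
have psi0 : psi 0 = 0 by rewrite /psi chi0 conjc0; case: ifP.
have psi1 : exists2 x, x != 0 & psi x != 1.
  have [x x0 cx] := chi1; exists x => //; rewrite /psi; case: ifP => // _.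
  by apply: contra cx => /eqP/(congr1 (@conjc R)); rewrite conjcK conjc1 => ->.
have -> : \sum_x \prod_i (if s i then chi (x + b i) else (chi (x + b i))^*)
    = \sum_y \prod_i psi ((b i - b i0) - y) ^+ e i.
  rewrite (reindex_inj (h := fun y => - y - b i0)) /=; last first.
    by move=> x y /addIr /oppr_inj.
  apply: eq_bigr => y _; apply: eq_bigr => i _.
  have -> : - y - b i0 + b i = b i - b i0 - y by ring.
  have cc z : (chi z)^* = chi z ^+ n by exact: conj_char.
  have cc' z : chi z = ((chi z)^*) ^+ n by rewrite -rmorphXn /= -cc; exact: esym (conjcK _).
  by rewrite /psi /e; case: (s i) (s i0) => -[] /=; rewrite ?expr1 // -?cc -?cc'.
apply: (@Weil_bound0 _ _ _ _ _ _ i0) => //.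
- by rewrite subrr.
- by rewrite /e eqxx.
- by move=> i /b0; rewrite subr_eq0.
Qed.

(** * The exponential and moments of twisted sums *)

Section ExponentialFunction.
Variable R : realType.
Implicit Types s t : R.

Lemma e0 : e (0 : R) = 1.
Proof. by rewrite /e mulr0 cos0 sin0. Qed.

Lemma eD s t : e (s + t) = e s * e t.
Proof. by rewrite /e mulrDr cosD sinD; apply/eqP; rewrite eq_complex /=; apply/andP; split; apply/eqP; ring. Qed.

Lemma eN t : e (- t) = (e t)^*.
Proof. by rewrite /e mulrN cosN sinN. Qed.

Lemma modulus_e t : modulus (e t) = 1.
Proof.
apply: complexI; rewrite modulusE normc_def /= cos2Dsin2 sqrtr1 //.
Qed.

Lemma e_nat (n : nat) : e (n%:R : R) = 1.
Proof.
elim: n => [|n IHn]; first exact: e0.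
rewrite -natr1 eD IHn mul1r /e mulr1 [2 * pi]mulrC mulr_natr.
by rewrite cos2pi sin2pi.
Qed.

Lemma e_int (k : int) : e (k%:~R : R) = 1.
Proof.
case: k => n; first exact: e_nat.
by rewrite NegzE mulrNz eN -pmulrn e_nat conjc1.
Qed.

Lemma eX t n : e (n%:R * t) = e t ^+ n.
Proof.
by elim: n => [|n IHn]; rewrite ?mul0r ?e0 // -natr1 mulrDl eD IHn mul1r exprSr.
Qed.

Lemma e_sum (I : Type) (r : seq I) (P : pred I) (f : I -> R) :
  e (\sum_(i <- r | P i) f i) = \prod_(i <- r | P i) e (f i).
Proof. exact: (big_morph (@e R) eD e0). Qed.

Lemma e_neq1 t : 0 < t < 1 -> e t != 1.
Proof.
move=> /andP[t0 t1]; apply/negP => /eqP[+ _].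
have -> : 2 * pi * t = pi * t + pi * t by ring.
have s0 : 0 < sin (pi * t).
  by apply: sin_gt0_pi; rewrite mulr_gt0 ?pi_gt0 //= gtr_pMr ?pi_gt0.
have := cos2Dsin2 (pi * t); rewrite cosD; set c := cos _; set s := sin _ in s0 *.
move=> h1 h2; have : s ^+ 2 = 0 by move: h1 h2; rewrite !expr2; lra.
by move/eqP; rewrite sqrf_eq0 => /eqP h; rewrite h ltxx in s0.
Qed.

Lemma sum_e_orthogonal (B : nat) (k : int) : (0 < B)%N ->
  \sum_(t < B) e (t%:R * (k%:~R / B%:R)) = if (B %| k)%Z then B%:R else 0 :> R[i].
Proof.
move=> B0; have B0' : (B%:R : R) != 0 by rewrite pnatr_eq0 -lt0n.
case: ifP => [/dvdzP[m ->]|Bk].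
  under eq_bigr => t _.
    rewrite intrM -pmulrn mulfK // -[t%:R]/((t : int)%:~R : R) -intrM e_int; over.
  by rewrite sumr_const card_ord.
have : (e (k%:~R / B%:R) - 1) * \sum_(t < B) e (t%:R * (k%:~R / B%:R)) = 0 :> R[i].
  under eq_bigr do rewrite eX.
  by rewrite -subrX1 -eX mulrCA mulfV // mulr1 e_int subrr.
move/eqP; rewrite mulf_eq0 => /orP[|/eqP//].
have kE : k = ((k %/ B)%Z * B + (k %% B)%Z)%R by exact: divz_eq.
have k0 : (0 <= (k %% B)%Z) by rewrite modz_ge0 // -lt0n.
have kB : ((k %% B)%Z < B) by rewrite ltz_pmod.
rewrite subr_eq0 {1}kE rmorphD rmorphM /= mulrDl -pmulrn mulfK // eD e_int mul1r.
have kn0 : (k %% B)%Z != 0 by apply: contraFneq Bk => /dvdz_mod0P.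
move: k0 kB kn0; case: (k %% B)%Z => // j _; rewrite ltz_nat => jB j0.
rewrite -pmulrn (negbTE (e_neq1 _)) // divr_gt0 ?ltr0n //= ?lt0n //.
by rewrite ltr_pdivrMr ?ltr0n // mul1r ltr_nat.
Qed.

Lemma sin_le_id t : 0 <= t -> `|sin t| <= t.
Proof.
move=> t0; have [c _] : exists2 c, c \in `[0, t] & sin t - sin 0 = cos c * (t - 0).
  apply: MVT_segment => //.
  by apply: derivable_within_continuous => x _; exact: ex_derive.
by rewrite sin0 !subr0 => ->; rewrite normrM (ger0_norm t0) ler_piMl // cos_max.
Qed.

Lemma cos_sub1_le_id t : 0 <= t -> `|cos t - 1| <= t.
Proof.
move=> t0; have [c _] : exists2 c, c \in `[0, t] & cos t - cos 0 = - sin c * (t - 0).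
  apply: (@MVT_segment _ _ (fun x => - sin x)) => //.
  by apply: derivable_within_continuous => x _; exact: ex_derive.
rewrite cos0 !subr0 => ->; rewrite normrM normrN (ger0_norm t0) ler_piMl //.
exact: sin_max.
Qed.

(** The constant is crude: with x = 2 pi t, both [cos x - 1] and [sin x] are at most x in absolute
    value, and x <= 8 t because pi < 4. *)
Lemma modulus_e_sub1 t : 0 <= t -> modulus (e t - 1) <= 16 * t.
Proof.
move=> t0; set x := 2 * pi * t.
have x0 : 0 <= x by rewrite !mulr_ge0 ?pi_ge0.
have -> : e t - 1 = (cos x - 1)%:C + 'i * (sin x)%:C.
  by apply/eqP; rewrite /e -/x eq_complex /=; apply/andP; split; apply/eqP; ring.
apply: le_trans (ler_modulusD _ _) _; rewrite modulusM !modulus_real.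
have -> : modulus ('i : R[i]) = 1.
  by apply: complexI; rewrite modulusE normc_def /= expr0n expr1n add0r sqrtr1.
have := sin_le_id x0; have := cos_sub1_le_id x0; rewrite mul1r.
have : x <= 8 * t.
  have p4 : pi < 4 :> R by have := pihalf_lt2 R; rewrite ltr_pdivrMr // -natrM.
  by rewrite ler_wpM2r //; lra.
lra.
Qed.

End ExponentialFunction.

(* Each factor of [`|sum_b f b| ^ (2 r)] is tagged by a pair (s, i); s tells
   whether it is conjugated. *)
Definition conj_unless (R : rcfType) (s : bool) (z : R[i]) : R[i] :=
  if s then z else z^*.

Arguments conj_unless : simpl never.

Section ConjUnless.
Variables (R : rcfType) (s : bool).
Implicit Types z w : R[i].

Lemma conj_unlessM z w : conj_unless s (z * w) = conj_unless s z * conj_unless s w.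
Proof. by rewrite /conj_unless; case: s => //=; rewrite rmorphM. Qed.

Lemma conj_unless_sum (I : finType) (f : I -> R[i]) :
  conj_unless s (\sum_i f i) = \sum_i conj_unless s (f i).
Proof. by rewrite /conj_unless; case: s => //=; rewrite rmorph_sum. Qed.

Lemma modulus_conj_unless z : modulus (conj_unless s z) = modulus z.
Proof. by rewrite /conj_unless; case: s => //=; exact: modulus_conj. Qed.

End ConjUnless.

Lemma modulus_sum_expand (R : rcfType) (J : finType) (r : nat) (f : J -> R[i]) :
  (modulus (\sum_b f b) ^+ (2 * r))%:C =
  \sum_(h : {ffun bool * 'I_r -> J}) \prod_p conj_unless p.1 (f (h p)).
Proof.
rewrite -(bigA_distr_bigA (fun p b => conj_unless p.1 (f b))) /=.
under [RHS]eq_bigr do rewrite -conj_unless_sum.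
rewrite exprM rmorphXn /= sqr_modulus.
rewrite -(pair_bigA _ (fun s (_ : 'I_r) => conj_unless s (\sum_b f b))) /=.
by rewrite big_bool /= !prodr_const card_ord -exprMn.
Qed.

(* A function taking each of its values at least twice factors through a set
   of half the size. *)
Lemma card_no_isolated_value (J : finType) (r : nat) :
  (#|[set h : {ffun bool * 'I_r -> J} |
       [forall p, exists p', (p' != p) && (h p' == h p)]]|
     <= r ^ (2 * r) * #|J| ^ r)%N.
Proof.
set S := [set h | _].
case: (posnP r) => [r0|r0].
  apply: leq_trans (max_card _) _.
  by rewrite card_ffun card_prod card_ord r0 !muln0 !expn0.
pose comp (u : {ffun bool * 'I_r -> 'I_r} * {ffun 'I_r -> J}) :
  {ffun bool * 'I_r -> J} := [ffun p => u.2 (u.1 p)].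
have -> : (r ^ (2 * r) * #|J| ^ r)%N =
    #|{: {ffun bool * 'I_r -> 'I_r} * {ffun 'I_r -> J}}|.
  by rewrite card_prod !card_ffun card_prod card_bool !card_ord.
apply: leq_trans (leq_imset_card comp predT).
apply/subset_leq_card/fintype.subsetP => h; rewrite inE => /forallP hh.
pose im := [set h p | p : bool * 'I_r].
have cim : (#|im| <= r)%N.
  have : (\sum_(y in im) 2 <= \sum_(y in im) \sum_(p | h p == y) 1)%N.
    apply: leq_sum => y /imsetP[p _ ->]; rewrite sum1_card.
    have /existsP[p' /andP[pp hp]] := hh p.
    have <- : #|[set p'; p]| = 2%N by rewrite cards2 pp.
    apply/subset_leq_card/fintype.subsetP => z; rewrite !inE.
    by case/orP => /eqP ->; [exact: hp | exact: eqxx].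
  rewrite sum_nat_const; have -> : (\sum_(y in im) \sum_(p | h p == y) 1 = 2 * r)%N.
    rewrite -[RHS]/((fun n => n * r) 2)%N -card_bool -[r in RHS]card_ord -card_prod.
    rewrite -sum1_card [RHS](partition_big h (mem im)) //= => p _.
    exact: imset_f.
  by rewrite mulnC leq_pmul2l.
have [j0] : exists j : J, j \in im by exists (h (true, Ordinal r0)); exact: imset_f.
move=> _; pose y j := nth j0 (enum im) j.
have idx p : (index (h p) (enum im) < r)%N.
  apply: leq_trans cim; rewrite cardE index_mem mem_enum; exact: imset_f.
apply/imsetP; exists ([ffun p => Ordinal (idx p)], [ffun j : 'I_r => y j]) => //.
apply/ffunP => p; rewrite !ffunE /= /y nth_index // mem_enum; exact: imset_f.
Qed.

Section Moment.
Variables (R : realType) (F : finFieldType) (chi : F -> R[i]).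
Hypotheses (chiM : monoid_morphism chi) (chi0 : chi 0 = 0).
Hypothesis chi_nonprincipal : exists2 x, x != 0 & chi x != 1.
Local Notation q := #|F|.

Variables (B r : nat) (beta : 'I_B -> F) (w : 'I_B -> R[i]).
Hypotheses (beta_inj : injective beta) (w_le1 : forall b, modulus (w b) <= 1).

Definition twisted_sum (x : F) (t : 'I_B) : R[i] :=
  \sum_b w b * e (t%:R * (b%:R / B%:R)) * chi (x + beta b).

Let sigma (h : {ffun bool * 'I_r -> 'I_B}) : int :=
  \sum_p (if p.1 then (h p : int) else - (h p : int)).

Let E (h : {ffun bool * 'I_r -> 'I_B}) : R := if (B %| sigma h)%Z then B%:R else 0.

Let prod_conj_e (h : {ffun bool * 'I_r -> 'I_B}) (t : nat) :
  \prod_p conj_unless p.1 (e (t%:R * ((h p)%:R / B%:R)) : R[i])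
    = e (t%:R * ((sigma h)%:~R / B%:R)).
Proof.
rewrite /sigma rmorph_sum /= mulr_suml mulr_sumr e_sum.
apply: eq_bigr => -[[] i] _; rewrite /conj_unless //.
by rewrite mulrNz mulNr mulrN eN.
Qed.

(** Read backwards, the left-hand side is the sum over t of the 2r-th powers of the plain
    exponential sums over b, and only t = 0 contributes. The result is one B-th of the trivial
    bound: this is the gain from averaging over t. *)
Let sum_E (B0 : (0 < B)%N) (r0 : (0 < r)%N) : \sum_h E h = B%:R ^+ (2 * r).
Proof.
apply: complexI; rewrite rmorph_sum /=.
transitivity (\sum_(h : {ffun bool * 'I_r -> 'I_B}) \sum_(t < B) \prod_p conj_unless p.1
    (e (t%:R * ((h p)%:R / B%:R)) : R[i])).
  apply: eq_bigr => h _; under eq_bigr do rewrite prod_conj_e.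
  by rewrite sum_e_orthogonal // /E; case: ifP => _; rewrite ?rmorph_nat.
rewrite exchange_big /=.
under eq_bigr do rewrite -(modulus_sum_expand r (fun b : 'I_B => e (_ * (b%:R / B%:R)))).
rewrite (bigD1 (Ordinal B0)) //= [X in _ + X]big1 ?addr0 => [|t t0].
  under eq_bigr do rewrite mul0r e0.
  by rewrite sumr_const card_ord modulus_nat.
suff -> : \sum_(b < B) e (t%:R * (b%:R / B%:R)) = 0 :> R[i].
  by rewrite modulus0 expr0n muln_eq0 /= (gtn_eqF r0).
transitivity (\sum_(b < B) e (b%:R * ((t : int)%:~R / B%:R)) : R[i]).
  by apply: eq_bigr => b _; rewrite mulrCA.
rewrite sum_e_orthogonal // -[(_ %| _)%Z]/(B %| t)%N gtnNdvd //.
by rewrite lt0n; apply: contraNneq t0 => t0; apply/eqP/val_inj.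
Qed.

(** The power is expanded over tuples [h]. If every value of [h] is repeated, the sum over x is
    bounded by [q] and [E h] by [B], and [card_no_isolated_value] counts such tuples. Otherwise some
    value occurs once, Weil's bound applies to the sum over x, and the weights [E h] are summed by
    [sum_E]. *)
Lemma twisted_sum_moment : (0 < B)%N -> (0 < r)%N ->
  \sum_x \sum_t modulus (twisted_sum x t) ^+ (2 * r)
    <= (r ^ (2 * r) * B ^ r * B * q)%:R + B%:R ^+ (2 * r) * ((2 * r)%:R * Num.sqrt q%:R).
Proof.
move=> B0 r0.
pose X (h : {ffun bool * 'I_r -> 'I_B}) :=
  \sum_x \prod_p conj_unless p.1 (chi (x + beta (h p))).
have -> : \sum_x \sum_t modulus (twisted_sum x t) ^+ (2 * r) =
    modulus (\sum_(h : {ffun bool * 'I_r -> 'I_B}) (\prod_p conj_unless p.1 (w (h p))) * (E h)%:C * X h).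
  have pos : 0 <= \sum_x \sum_t modulus (twisted_sum x t) ^+ (2 * r).
    by apply: sumr_ge0 => x _; apply: sumr_ge0 => t _; rewrite exprn_ge0 ?modulus_ge0.
  rewrite -[LHS](ger0_norm pos) -modulus_real; congr modulus.
  rewrite rmorph_sum /=; under eq_bigr do rewrite rmorph_sum /=.
  under eq_bigr do under eq_bigr do rewrite modulus_sum_expand.
  under eq_bigr do rewrite exchange_big /=.
  rewrite exchange_big /=; apply: eq_bigr => h _.
  rewrite /X mulr_sumr; apply: eq_bigr => x _.
  have -> : (E h)%:C = \sum_(t < B) \prod_p conj_unless p.1
      (e (t%:R * ((h p)%:R / B%:R)) : R[i]).
    under eq_bigr do rewrite prod_conj_e.
    by rewrite sum_e_orthogonal // /E; case: ifP => _; rewrite ?rmorph_nat.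
  rewrite mulr_sumr mulr_suml; apply: eq_bigr => t _.
  by rewrite -!big_split /=; apply: eq_bigr => p _; rewrite !conj_unlessM.
have E0 h : 0 <= E h by rewrite /E; case: ifP.
have EB h : E h <= B%:R by rewrite /E; case: ifP.
apply: le_trans (ler_modulus_sum _ _ _) _.
pose bad (h : {ffun bool * 'I_r -> 'I_B}) :=
  [forall p, exists p', (p' != p) && (h p' == h p)].
have term (h : {ffun bool * 'I_r -> 'I_B}) : modulus ((\prod_p conj_unless p.1 (w (h p))) * (E h)%:C * X h)
    <= (if bad h then B%:R * q%:R else 0) + E h * ((2 * r)%:R * Num.sqrt q%:R).
  rewrite 2!modulusM modulus_prod modulus_real (ger0_norm (E0 h)).
  apply: (@le_trans _ _ (E h * modulus (X h))).
    rewrite ler_wpM2r ?modulus_ge0 // ler_piMl ?E0 //.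
    apply: prodr_ile1 => p _; by rewrite modulus_conj_unless w_le1 modulus_ge0.
  case: ifPn => [_|/forallPn[p /existsPn pP]].
    apply: ler_wpDr; first by rewrite !mulr_ge0 ?E0 ?sqrtr_ge0.
    apply: ler_pM; rewrite ?E0 ?modulus_ge0 ?EB //.
    apply: le_trans (ler_modulus_sum _ _ _) _.
    rewrite -sum1_card natr_sum; apply: ler_sum => x _.
    rewrite modulus_prod; apply: prodr_ile1 => i _.
    by rewrite modulus_conj_unless modulus_ge0 modulus_char_le1.
  rewrite add0r ler_wpM2l ?E0 //.
  have -> : (2 * r)%:R = #|{: bool * 'I_r}|%:R :> R.
    by rewrite card_prod card_bool card_ord.
  apply: (@Weil_bound _ _ _ _ (fun p => beta (h p)) fst p) => // i ip.
  by apply: contraNneq (pP i) => /beta_inj ->; rewrite ip eqxx.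
apply: le_trans (ler_sum _ (fun h _ => term h)) _.
rewrite big_split /= -mulr_suml sum_E // lerD2r -big_mkcond /= sumr_const.
rewrite -[_ *+ _]mulr_natr -!natrM ler_nat.
rewrite -[leqRHS]mulnA [leqRHS]mulnC leq_mul //.
by have := card_no_isolated_value 'I_B r; rewrite card_ord cardsE.
Qed.

End Moment.

(** * The multiplicity of the ratios n / a *)

Lemma Cauchy_Schwarz_sum (R : realDomainType) (T : finType) (a b : T -> R) :
  (\sum_i a i * b i) ^+ 2 <= (\sum_i a i ^+ 2) * (\sum_i b i ^+ 2).
Proof.
rewrite -subr_ge0 -(pmulr_rge0 _ (ltr0n R 2)).
suff -> : 2%:R * ((\sum_i a i ^+ 2) * (\sum_i b i ^+ 2) - (\sum_i a i * b i) ^+ 2)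
    = \sum_i \sum_j (a i * b j - a j * b i) ^+ 2.
  by apply: sumr_ge0 => i _; apply: sumr_ge0 => j _; exact: sqr_ge0.
have -> : \sum_i \sum_j (a i * b j - a j * b i) ^+ 2 =
   \sum_i \sum_j a i ^+ 2 * b j ^+ 2 + \sum_j \sum_i a j ^+ 2 * b i ^+ 2
   - 2%:R * \sum_i \sum_j (a i * b i) * (a j * b j).
  rewrite [X in _ = _ + X - _]exchange_big /= mulr_sumr -big_split -sumrB /=.
  apply: eq_bigr => i _; rewrite mulr_sumr -big_split -sumrB /=.
  by apply: eq_bigr => j _; ring.
by rewrite -!big_distrlr /= expr2; ring.
Qed.

(** The induction step is Chebyshev's sum inequality for [g] and [g ^+ r.+1], which are similarly
    ordered: twice the difference of the two sides is a double sum of nonnegative terms. *)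
Lemma power_mean_sum (R : realDomainType) (T : finType) (nu g : T -> R) (r : nat) :
  (forall i, 0 <= nu i) -> (forall i, 0 <= g i) ->
  (\sum_i nu i * g i) ^+ r.+1 <= (\sum_i nu i) ^+ r * \sum_i nu i * g i ^+ r.+1.
Proof.
move=> nu0 g0; have sn0 : 0 <= \sum_i nu i by exact: sumr_ge0.
elim: r => [|r IHr]; first by rewrite !expr1 expr0 mul1r.
rewrite exprS; apply: le_trans (_ : (\sum_i nu i * g i) *
    ((\sum_i nu i) ^+ r * \sum_i nu i * g i ^+ r.+1) <= _).
  by rewrite ler_wpM2l // sumr_ge0 // => i _; rewrite mulr_ge0.
rewrite mulrCA exprSr -mulrA ler_wpM2l ?exprn_ge0 //.
rewrite -subr_ge0 -(pmulr_rge0 _ (ltr0n R 2)).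
suff -> : 2%:R * ((\sum_i nu i) * (\sum_i nu i * g i ^+ r.+2)
      - (\sum_i nu i * g i) * \sum_i nu i * g i ^+ r.+1)
    = \sum_i \sum_j nu i * nu j * ((g i - g j) * (g i ^+ r.+1 - g j ^+ r.+1)).
  apply: sumr_ge0 => i _; apply: sumr_ge0 => j _; apply: mulr_ge0; first by rewrite mulr_ge0.
  have [ij|/ltW ij] := lerP (g i) (g j).
    by apply: mulr_le0; rewrite subr_le0 ?ler_pXn2r ?nnegrE ?g0.
  by apply: mulr_ge0; rewrite subr_ge0 ?ler_pXn2r ?nnegrE ?g0.
have -> : \sum_i \sum_j nu i * nu j * ((g i - g j) * (g i ^+ r.+1 - g j ^+ r.+1)) =
   \sum_i \sum_j nu i * (nu j * g j ^+ r.+2) + \sum_j \sum_i nu j * (nu i * g i ^+ r.+2)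
   - (\sum_i \sum_j (nu i * g i) * (nu j * g j ^+ r.+1)
     + \sum_j \sum_i (nu j * g j) * (nu i * g i ^+ r.+1)).
  rewrite [X in _ = _ + X - _]exchange_big [X in _ = _ - (_ + X)]exchange_big /=.
  rewrite -!big_split -sumrB /=.
  apply: eq_bigr => i _; rewrite -!big_split -sumrB /=.
  by apply: eq_bigr => j _; rewrite !exprS; ring.
by rewrite -!big_distrlr /=; ring.
Qed.

(** With [nu] the fibre sizes of [phi], the sum of [nu] is [#|P|] and the sum of [nu ^+ 2] counts
    coincidences. The power mean inequality with exponent r is followed by Cauchy-Schwarz, which
    separates [nu] from [g ^+ r]. *)
Lemma Holder_image (R : realFieldType) (P Y : finType) (phi : P -> Y) (g : Y -> R)
    (r : nat) : (0 < r)%N -> (forall y, 0 <= g y) ->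
  (\sum_p g (phi p)) ^+ (2 * r) <=
  #|P|%:R ^+ (2 * r - 2) * #|[set pp : P * P | phi pp.1 == phi pp.2]|%:R
    * \sum_y g y ^+ (2 * r).
Proof.
case: r => // r _ g0; pose nu y : R := \sum_(p | phi p == y) 1.
have nu0 y : 0 <= nu y by exact: sumr_ge0.
have -> : \sum_p g (phi p) = \sum_y nu y * g y.
  rewrite (partition_big phi xpredT) //=; apply: eq_bigr => y _.
  by rewrite mulr_suml; apply: eq_bigr => p /eqP ->; rewrite mul1r.
have nuP : \sum_y nu y = #|P|%:R.
  by rewrite -sum1_card natr_sum [RHS](partition_big phi xpredT).
have nu2 : \sum_y nu y ^+ 2 = #|[set pp : P * P | phi pp.1 == phi pp.2]|%:R.
  rewrite cardsE -sum1_card natr_sum.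
  rewrite (partition_big (fun pp : P * P => phi pp.1) xpredT) //=.
  apply: eq_bigr => y _; rewrite expr2 /nu big_distrlr /= pair_big_dep /=.
  apply: eq_big => [[p p'] /=|]; last by move=> *; rewrite mulr1.
  by rewrite -topredE /=; case: eqP => [->|]; rewrite ?andbF ?andbT //= eq_sym.
have -> : (2 * r.+1 - 2 = r * 2)%N by rewrite mulnS addKn mulnC.
rewrite -nu2 -nuP mulnC exprM.
apply: (@le_trans _ _ (((\sum_y nu y) ^+ r * \sum_y nu y * g y ^+ r.+1) ^+ 2)).
  rewrite ler_pXn2r ?nnegrE ?power_mean_sum ?exprn_ge0 ?mulr_ge0 ?exprn_ge0 //.
  - by apply: sumr_ge0 => y _; rewrite mulr_ge0.
  - exact: sumr_ge0.
  - by apply: sumr_ge0 => y _; rewrite mulr_ge0 ?exprn_ge0.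
rewrite exprMn -exprM -mulrA ler_wpM2l ?exprn_ge0 ?sumr_ge0 //.
under [X in _ <= _ * X]eq_bigr do rewrite exprM.
exact: Cauchy_Schwarz_sum.
Qed.

Lemma natr_Fp_inj (q n m : nat) : prime q -> (n < q)%N -> (m < q)%N ->
  n%:R = m%:R :> 'F_q -> n = m.
Proof.
move=> pq nq mq /(congr1 val) /=.
by rewrite !val_Fp_nat // !modn_small.
Qed.

Definition harmonic_sum (R : fieldType) (n : nat) : R := \sum_(1 <= g < n.+1) g%:R^-1.

Lemma card_dvd_shift (A g : nat) : (0 < g)%N ->
  (#|[set i : 'I_A | g %| A + i]| <= (2 * A) %/ g)%N.
Proof.
move=> g0; set S := [set i | _].
have lt (i : 'I_A) : i \in S -> (((A + i) %/ g).-1 < (2 * A) %/ g)%N.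
  rewrite inE => gi; have i1 : (0 < (A + i) %/ g)%N.
    by rewrite divn_gt0 // dvdn_leq // addn_gt0 (leq_ltn_trans _ (ltn_ord i)).
  rewrite prednK // leq_div2r // mul2n -addnn leq_add2l ltnW //.
case: (posnP ((2 * A) %/ g)%N) => [n0|n0].
  rewrite n0 leqn0 cards_eq0; apply/eqP/setP => i; rewrite finset.in_set0.
  by apply/negP => /lt; rewrite n0.
pose f (i : 'I_A) := insubd (Ordinal n0) ((A + i) %/ g).-1.
rewrite -[leqRHS]card_ord -(card_in_imset (f := f)) ?max_card // => i j iS jS.
move/(congr1 val); rewrite !val_insubd !lt //.
have pos (k : 'I_A) : k \in S -> (0 < (A + k) %/ g)%N.
  by rewrite inE => gk; rewrite divn_gt0 // dvdn_leq // addn_gt0 (leq_ltn_trans _ (ltn_ord k)).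
move/(congr1 succn); rewrite !prednK ?pos // => ij; apply/val_inj/(@addnI A).
move: iS jS; rewrite !inE => /divnK iE /divnK jE; by rewrite -iE ij jE.
Qed.

(** A gcd is at most the sum of all common divisors. Each [g] divides at most [2 * A / g] of the
    numbers [A + i], and the terms g * (2 A / g) ^ 2 add up to the harmonic sum. *)
Lemma sum_gcdn_shift (R : realFieldType) (A : nat) :
  \sum_(i < A) \sum_(j < A) (gcdn (A + i) (A + j))%:R
    <= (2 * A)%:R ^+ 2 * harmonic_sum R (2 * A).
Proof.
apply: (@le_trans _ _ (\sum_(i < A) \sum_(j < A) \sum_(1 <= g < (2 * A).+1)
    (if (g %| A + i)%N && (g %| A + j)%N then g%:R else 0))).
  apply: ler_sum => i _; apply: ler_sum => j _.
  have A0 : (0 < A)%N by exact: leq_ltn_trans (ltn_ord i).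
  have g0 : (0 < gcdn (A + i) (A + j))%N by rewrite gcdn_gt0 addn_gt0 A0.
  rewrite (bigD1_seq (gcdn (A + i) (A + j))) ?iota_uniq //=; last first.
    rewrite mem_index_iota g0 ltnS (leq_trans (dvdn_leq _ (dvdn_gcdl _ _))) ?addn_gt0 ?A0 //.
    by rewrite mul2n -addnn leq_add2l ltnW.
  rewrite dvdn_gcdl dvdn_gcdr lerDl; apply: sumr_ge0 => g _; by case: ifP.
under eq_bigr do rewrite exchange_big /=.
rewrite exchange_big /harmonic_sum mulr_sumr /= !big_nat; apply: ler_sum => g /andP[g0 _].
pose c := #|[set i : 'I_A | (g %| A + i)%N]|.
have -> : \sum_(i < A) \sum_(j < A) (if (g %| A + i)%N && (g %| A + j)%N then g%:R else 0)
   = c%:R ^+ 2 * g%:R :> R.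
  rewrite /c cardsE -sum1_card natr_sum expr2 big_distrlr mulr_suml [RHS]big_mkcond /=.
  apply: eq_bigr => i _; rewrite [X in if X then _ else 0](_ : _ = (g %| A + i)%N) //.
  case: ifP => gi; last first.
    by rewrite big1 // => j _; rewrite gi.
  rewrite mulr_suml [RHS]big_mkcond /=; apply: eq_bigr => j _.
  by rewrite mulr1 mul1r.
have g0' : 0 < g%:R :> R by rewrite ltr0n.
rewrite ler_pdivlMr // -mulrA -expr2 -exprMn ler_pXn2r ?nnegrE //.
by rewrite -natrM ler_nat -leq_divRL // card_dvd_shift.
Qed.

(** For two solutions, subtraction removes [N], and [4 * (A * H) <= q] makes the resulting
    congruence an equality of natural numbers. Hence the first components agree modulo a / gcd(a,
    a'), and the first component determines the second. *)
Lemma card_same_ratio (q A H a a' : nat) (N : 'F_q) : prime q ->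
  (0 < A)%N -> (4 * (A * H) <= q)%N -> (A <= a < 2 * A)%N -> (A <= a' < 2 * A)%N ->
  (#|[set uu : 'I_H * 'I_H | ((N + uu.1%:R) * a'%:R == (N + uu.2%:R) * a%:R)%R]|
    <= H %/ (a %/ gcdn a a') + 1)%N.
Proof.
move=> pq A0 AH /andP[Aa aA] /andP[Aa' a'A]; set S := [set uu | _].
have a0 : (0 < a)%N by exact: leq_trans Aa.
have g0 : (0 < gcdn a a')%N by rewrite gcdn_gt0 a0.
set m := (a %/ gcdn a a')%N.
have m0 : (0 < m)%N by rewrite divn_gt0 // dvdn_leq // dvdn_gcdl.
have key (u u' v v' : 'I_H) : (u, u') \in S -> (v, v') \in S ->
    (u * a' + v' * a = v * a' + u' * a)%N.
  rewrite !inE /= => /eqP E1 /eqP E2.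
  have lt (x y : 'I_H) : (x * a' + y * a < q)%N.
    have h1 : (x * a' <= H * (2 * A))%N by rewrite leq_mul // ltnW.
    have h2 : (y * a < H * (2 * A))%N by rewrite ltn_mul.
    by apply: leq_trans AH; lia.
  apply: (natr_Fp_inj pq) => //; rewrite !natrD !natrM.
  apply: (@addrI _ (N * a'%:R + N * a%:R)).
  have -> : N * a'%:R + N * a%:R + (u%:R * a'%:R + v'%:R * a%:R) =
    (N + u%:R) * a'%:R + (N + v'%:R) * a%:R by ring.
  by rewrite E1 -E2; ring.
have m_dvd (u u' v v' : 'I_H) : (u, u') \in S -> (v, v') \in S -> u = v %[mod m].
  move=> uS vS; have E := key _ _ _ _ uS vS.
  have aE : a = (m * gcdn a a')%N by rewrite divnK // dvdn_gcdl.
  have cop : coprime m (a' %/ gcdn a a').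
    rewrite /coprime -(eqn_pmul2r g0) muln_gcdl !divnK ?dvdn_gcdl ?dvdn_gcdr //.
    by rewrite mul1n.
  have a'E : a' = (a' %/ gcdn a a' * gcdn a a')%N by rewrite divnK // dvdn_gcdr.
  wlog uv : u u' v v' uS vS E / (v <= u)%N.
    move=> W; case: (leqP v u) => [|/ltnW] vu; first exact: W uS vS _ _.
    by symmetry; apply: W vS uS _ vu; exact: esym.
  apply/eqP; rewrite eqn_mod_dvd // -(Gauss_dvdl _ cop).
  rewrite -(dvdn_pmul2r g0) -mulnA -a'E -aE mulnBl.
  apply/dvdnP; exists (u' - v')%N; rewrite mulnBl; lia.
pose f (uu : 'I_H * 'I_H) : 'I_(H %/ m).+1 := inord (uu.1 %/ m).
rewrite addn1 -[leqRHS]card_ord -(card_in_imset (f := f)) ?max_card // => -[u u'] [v v'] uS vS.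
move/(congr1 val); rewrite /f /= !inordK ?ltnS ?leq_div2r // 1?ltnW // => duv.
have uv : u = v.
  by apply: val_inj; rewrite /= (divn_eq u m) (divn_eq v m) duv (m_dvd _ _ _ _ uS vS).
have := key _ _ _ _ uS vS; rewrite uv => /addnI /eqP; rewrite eqn_pmul2r //.
by move=> /eqP/val_inj ->.
Qed.

(** * Shifting *)

Lemma harmonic_sum_ge1 (R : realFieldType) n : (0 < n)%N -> 1 <= harmonic_sum R n.
Proof.
case: n => // n _; rewrite /harmonic_sum big_ltn // invr1 lerDl.
by apply: sumr_ge0 => g _; rewrite invr_ge0.
Qed.

(** The component [t] only adds a condition to a coincidence of ratios. Of the constant, 4 comes
    from the square of [2 * A] in [sum_gcdn_shift] and 1 from the [+ 1] of [card_same_ratio], whose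
    total [A * A] is absorbed by [A <= H]. *)
Lemma card_shifted_ratios (R : realFieldType) (q A H : nat) (N : 'F_q) (T : finType)
    (t : 'I_A -> T) (phi := fun p : 'I_A * 'I_H => ((N + p.2%:R) / (A + p.1)%:R, t p.1)) :
  prime q -> (0 < A <= H)%N -> (4 * (A * H) <= q)%N ->
  #|[set pp | phi pp.1 == phi pp.2]|%:R <= 5 * (A * H)%:R * harmonic_sum R (2 * A).
Proof.
move=> pq /andP[A0 AH] AHq.
have A0' : 0 < A%:R :> R by rewrite ltr0n.
have unit (i : 'I_A) : (A + i)%:R != 0 :> 'F_q.
  apply/eqP => /(natr_Fp_inj (m := 0) pq) h.
  have : (A + i < q)%N.
    by apply: leq_trans AHq; have := ltn_ord i; move: (i : nat) => j; nia.
  by move/h => /(_ (prime_gt0 pq)) /eqP; rewrite addn_eq0 (gtn_eqF A0).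
pose S (i j : 'I_A) := [set uu : 'I_H * 'I_H |
   ((N + uu.1%:R) * (A + j)%:R == (N + uu.2%:R) * (A + i)%:R)%R].
have le1 : (#|[set pp | phi pp.1 == phi pp.2]| <= \sum_(i < A) \sum_(j < A) #|S i j|)%N.
  rewrite cardsE -sum1_card.
  rewrite (partition_big (fun pp : ('I_A * 'I_H) * ('I_A * 'I_H) => (pp.1.1, pp.2.1)) xpredT) //=.
  rewrite [leqRHS]pair_big /=; apply: leq_sum => -[i j] _ /=.
  rewrite sum1_card.
  pose f (pp : ('I_A * 'I_H) * ('I_A * 'I_H)) := (pp.1.2, pp.2.2).
  rewrite -(card_in_imset (f := f)); last first.
    move=> [[a b] [c d]] [[a' b'] [c' d']]; rewrite !unfold_in /=.
    by move=> /andP[_ /eqP[-> ->]] /andP[_ /eqP[-> ->]] [-> ->].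
  apply/subset_leq_card/fintype.subsetP => uu /imsetP[[[a u] [b v]] uv ->].
  move: uv; rewrite unfold_in /= => /andP[uv /eqP[ai bj]].
  move: uv; rewrite unfold_in /= => /andP[/eqP h _].
  rewrite ai bj in h.
  rewrite inE /f /=; apply/eqP; rewrite -[N + u%:R](divfK (unit i)) h.
  by rewrite mulrAC divfK.
apply: (@le_trans _ _ (\sum_(i < A) \sum_(j < A)
    (H%:R / A%:R * (gcdn (A + i) (A + j))%:R + 1))).
  apply: (@le_trans _ _ (\sum_(i < A) \sum_(j < A) #|S i j|)%:R); first by rewrite ler_nat.
  rewrite natr_sum; apply: ler_sum => i _; rewrite natr_sum; apply: ler_sum => j _.
  have bd (k : 'I_A) : (A <= A + k < 2 * A)%N.
    by rewrite leq_addr mul2n -addnn ltn_add2l ltn_ord.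
  have := @card_same_ratio q A H _ _ N pq A0 AHq (bd i) (bd j).
  rewrite -(ler_nat R) => /le_trans; apply.
  rewrite natrD lerD2r mulrAC ler_pdivlMr // -!natrM ler_nat.
  have gE : ((A + i) %/ gcdn (A + i) (A + j) * gcdn (A + i) (A + j) = A + i)%N.
    by rewrite divnK // dvdn_gcdl.
  apply: (@leq_trans (H %/ ((A + i) %/ gcdn (A + i) (A + j)) * (A + i))).
    by rewrite leq_mul2l leq_addr orbT.
  by rewrite -[in X in (_ * X)%N]gE mulnA leq_mul2r leq_trunc_div orbT.
have -> : \sum_(i < A) \sum_(j < A) (H%:R / A%:R * (gcdn (A + i) (A + j))%:R + 1) =
   H%:R / A%:R * (\sum_(i < A) \sum_(j < A) (gcdn (A + i) (A + j))%:R) + A%:R * A%:R :> R.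
  under eq_bigr do rewrite big_split sumr_const card_ord /= -mulr_sumr.
  by rewrite big_split /= sumr_const card_ord -mulr_sumr -[A%:R *+ A]mulr_natr.
have h1 := harmonic_sum_ge1 R (n := 2 * A); set h := harmonic_sum _ _ in h1 *.
apply: (@le_trans _ _ (H%:R / A%:R * ((2 * A)%:R ^+ 2 * h) + A%:R * A%:R)).
  by rewrite lerD2r ler_wpM2l ?divr_ge0 // sum_gcdn_shift.
have {}h1 : 1 <= h by apply: h1; rewrite muln_gt0.
rewrite !natrM; have -> : H%:R / A%:R * ((2%:R * A%:R) ^+ 2 * h) = 4 * (A%:R * H%:R) * h.
  by field; rewrite gt_eqF.
have : A%:R * A%:R <= (A%:R * H%:R) * h.
  apply: (@le_trans _ _ (A%:R * H%:R)); first by rewrite ler_wpM2l ?ler_nat.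
  by rewrite ler_peMr ?mulr_ge0.
lra.
Qed.

Lemma Abel_sum (C : comNzRingType) (c y : nat -> C) (B : nat) :
  \sum_(b < B) c b * y b =
  c B * \sum_(b < B) y b - \sum_(k < B) (c k.+1 - c k) * \sum_(b < k.+1) y b.
Proof.
elim: B => [|B IHB]; first by rewrite !big_ord0 mulr0 subr0.
by rewrite 3!big_ord_recr /= IHB [\sum_(b < B.+1) y b]big_ord_recr /=; ring.
Qed.

(** Here [t] is the floor of [theta * B] modulo [B], so theta - t / B lies, up to an integer,
    between 0 and 1 / B, and consecutive residual phases differ by at most 16 / B. The index [t] is
    chosen before [z], so it will depend on a and not on n. Partial sums are written as full sums
    with weights 0 and 1, to fit [twisted_sum]. *)
Lemma Abel_e_bound (R : realType) (B : nat) (theta : R) : (0 < B)%N ->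
  exists t : 'I_B, forall z : nat -> R[i],
    modulus (\sum_(b < B) e (b%:R * theta) * z b) <=
      modulus (\sum_(b < B) e (t%:R * (b%:R / B%:R)) * z b) +
      16 / B%:R * \sum_(k < B)
        modulus (\sum_(b < B) ((b <= k)%N)%:R * e (t%:R * (b%:R / B%:R)) * z b).
Proof.
move=> B0; have B0' : 0 < B%:R :> R by rewrite ltr0n.
pose n := Num.floor (theta * B%:R).
have nB0 : (0 <= (n %% B)%Z) by rewrite modz_ge0 // -lt0n.
have t_lt : (`|(n %% B)%Z| < B)%N by rewrite -ltz_nat gez0_abs // ltz_pmod.
pose t := Ordinal t_lt; exists t => z.
pose delta := theta - n%:~R / B%:R.
have d0 : 0 <= delta by rewrite subr_ge0 ler_pdivrMr // floor_le.
have d1 : delta <= B%:R^-1.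
  rewrite lerBlDr -[X in X + _]mul1r -mulrDl ler_pdivlMr // ltW //.
  by have := floorD1_gt (theta * B%:R); rewrite intrD addrC.
pose y (b : nat) : R[i] := e (t%:R * (b%:R / B%:R)) * z b.
have zE (b : nat) : e (b%:R * theta) * z b = e (b%:R * delta) * y b.
  rewrite /y mulrA -eD; congr (_ * _).
  have nE : n%:~R = (n %/ B)%Z%:~R * B%:R + t%:R :> R.
    rewrite {1}(divz_eq n B) intrD intrM; congr (_ + _).
    by rewrite -[t%:R]/((t : int)%:~R : R) /t /= gez0_abs.
  have -> : b%:R * theta = (b%:R * delta + t%:R * (b%:R / B%:R))
      + ((b : int) * (n %/ B)%Z)%:~R :> R.
    rewrite intrM -[(b : int)%:~R]/(b%:R : R) /delta nE.
    by field; rewrite gt_eqF.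
  by rewrite [LHS]eD e_int mulr1.
under eq_bigr do rewrite zE.
rewrite (Abel_sum (fun b => e (b%:R * delta)) y).
apply: le_trans (ler_modulusD _ _) _; rewrite modulusN modulusM modulus_e mul1r.
rewrite lerD2l mulr_sumr; apply: le_trans (ler_modulus_sum _ _ _) _.
apply: ler_sum => k _; rewrite modulusM.
have -> : \sum_(b < k.+1) y b =
    \sum_(b < B) ((b <= k)%N)%:R * e (t%:R * (b%:R / B%:R)) * z b.
  rewrite (big_ord_widen _ y (ltn_ord k)) [LHS]big_mkcond; apply: eq_bigr => b _.
  by rewrite ltnS /y; case: (b <= k)%N; rewrite ?mul1r ?mul0r.
rewrite ler_wpM2r ?modulus_ge0 //.
have -> : e (k.+1%:R * delta) - e (k%:R * delta) = e (k%:R * delta) * (e delta - 1).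
  by rewrite -natr1 mulrDl mul1r eD; ring.
rewrite modulusM modulus_e mul1r; apply: le_trans (modulus_e_sub1 d0) _.
by rewrite ler_wpM2l.
Qed.

Section Shift.
Variables (R : rcfType) (G : int -> R[i]).

Definition interval_sum (N : int) (H : nat) : R[i] := \sum_(u < H) G (N + u).

Lemma interval_sumD N (H K : nat) :
  interval_sum N (H + K) = interval_sum N H + interval_sum (N + H) K.
Proof.
rewrite /interval_sum big_split_ord /=; congr (_ + _).
by apply: eq_bigr => u _; rewrite PoszD addrA.
Qed.

Lemma interval_sum_shift N (H h : nat) :
  interval_sum N H =
  interval_sum (N + h) H + (interval_sum N h - interval_sum (N + H) h).
Proof.
have := interval_sumD N h H; rewrite addnC interval_sumD => E.
by rewrite addrCA addrA -E addrK.
Qed.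

End Shift.

Section BurgessStep.
Variables (R : realType) (q : nat) (chi : 'F_q -> R[i]).
Hypotheses (q_prime : prime q) (chiM : monoid_morphism chi) (chi0 : chi 0 = 0).
Hypothesis chi_nonprincipal : exists2 x, x != 0 & chi x != 1.

Definition twisted_char (alpha : R) (n : int) : R[i] :=
  e (alpha * n%:~R) * chi n%:~R.

Lemma twisted_charD alpha (N : int) (a b : nat) : a%:R != 0 :> 'F_q ->
  twisted_char alpha (N + (a * b)%N) =
  e (alpha * N%:~R) * chi a%:R *
    (e (b%:R * (alpha * a%:R)) * chi (N%:~R / a%:R + b%:R)).
Proof.
move=> a0; case: chiM => _ cM.
rewrite /twisted_char !intrD -[(a * b)%N%:~R]/((a * b)%:R) natrM mulrDr eD.
rewrite -[(a * b)%N%:~R]/((a * b)%:R : 'F_q) natrM.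
have -> : N%:~R + a%:R * b%:R = a%:R * (N%:~R / a%:R + b%:R) :> 'F_q.
  by rewrite mulrDr mulrCA divff // mulr1.
rewrite cM -[(a%:R * b%:R : R)]/(a%:R * b%:R).
have -> : alpha * (a%:R * b%:R) = b%:R * (alpha * a%:R) by ring.
by rewrite !mulrA; congr (_ * _); rewrite -!mulrA; congr (_ * _); rewrite mulrC.
Qed.

(** [Y] bounds the sum over all pairs (a, n) of the moduli of [twisted_sum], for any weights of
    modulus at most 1. In 17 = 1 + 16, the 1 is the full sum and the 16 the average of the truncated
    ones from Abel summation; [2 * M] accounts for the two edges of a translate. *)
Lemma Burgess_step (alpha : R) (N : int) (A B H r : nat) (Y M : R) :
  (0 < A <= H)%N -> (0 < B <= q)%N -> (0 < r)%N -> (4 * (A * H) <= q)%N ->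
  0 <= Y ->
  (A * H)%:R ^+ (2 * r - 2) * (5 * (A * H)%:R * harmonic_sum R (2 * A)) *
    ((r ^ (2 * r) * B ^ r * B * q)%:R + B%:R ^+ (2 * r) * ((2 * r)%:R * Num.sqrt q%:R))
    <= Y ^+ (2 * r) ->
  (forall (N' : int) (a b : nat), (a < 2 * A)%N -> (b < B)%N ->
     modulus (interval_sum (twisted_char alpha) N' (a * b)) <= M) ->
  (A * B)%:R * modulus (interval_sum (twisted_char alpha) N H)
    <= 17 * Y + (A * B)%:R * (2 * M).
Proof.
move=> /andP[A0 AH] /andP[B0 Bq] r0 AHq Y0 YE hM.
set S := interval_sum _.
have cq : #|'F_q| = q by rewrite card_Fp.
have unit (i : 'I_A) : (A + i)%:R != 0 :> 'F_q.
  apply/eqP => /(natr_Fp_inj (m := 0) q_prime) h.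
  have : (A + i < q)%N.
    by apply: leq_trans AHq; have := ltn_ord i; move: (i : nat) => j; nia.
  by move/h => /(_ (prime_gt0 q_prime)) /eqP; rewrite addn_eq0 (gtn_eqF A0).
have [t tP] := choice (fun i : 'I_A => Abel_e_bound (alpha * (A + i)%:R) B0).
pose phi (p : 'I_A * 'I_H) := ((N%:~R + p.2%:R) / (A + p.1)%:R : 'F_q, t p.1).
pose beta (b : 'I_B) : 'F_q := b%:R.
have beta_inj : injective beta.
  move=> b b' /(natr_Fp_inj q_prime) h; apply/val_inj/h.
    exact: leq_trans (ltn_ord _) Bq.
  exact: leq_trans (ltn_ord _) Bq.
have avg (w : 'I_B -> R[i]) : (forall b, modulus (w b) <= 1) ->
    \sum_p modulus (twisted_sum chi beta w (phi p).1 (phi p).2) <= Y.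
  move=> w1; rewrite -(ler_pXn2r (n := 2 * r)) ?muln_gt0 ?nnegrE ?sumr_ge0 // => [|p _].
    apply: le_trans YE; apply: le_trans (Holder_image phi
      (g := fun y => modulus (twisted_sum chi beta w y.1 y.2)) r0 _) _.
      by move=> y; exact: modulus_ge0.
    have m1 := twisted_sum_moment chiM chi0 chi_nonprincipal beta_inj w1 B0 r0.
    rewrite cq in m1; rewrite card_prod !card_ord.
    apply: ler_pM; rewrite ?mulr_ge0 ?exprn_ge0 ?ler0n //.
    - by apply: sumr_ge0 => y _; rewrite exprn_ge0 ?modulus_ge0.
    - by rewrite ler_wpM2l ?exprn_ge0 // card_shifted_ratios ?A0.
    by rewrite -(pair_bigA _ (fun x t => modulus (twisted_sum chi beta w x t) ^+ (2 * r))).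
  exact: modulus_ge0.
have main : modulus (\sum_(i < A) \sum_(b < B) S (N + ((A + i) * b)%N) H) <= 17 * Y.
  have -> : \sum_(i < A) \sum_(b < B) S (N + ((A + i) * b)%N) H =
      \sum_(p : 'I_A * 'I_H) \sum_(b < B) twisted_char alpha (N + p.2 + ((A + p.1) * b)%N).
    rewrite -(pair_bigA _ (fun (i : 'I_A) (u : 'I_H) => \sum_(b < B)
        twisted_char alpha (N + (u : nat) + ((A + i) * b)%N))) /=.
    apply: eq_bigr => i _; rewrite exchange_big /=; apply: eq_bigr => u _.
    by apply: eq_bigr => b _; rewrite addrAC.
  apply: le_trans (ler_modulus_sum _ _ _) _.
  apply: (@le_trans _ _ (\sum_p (modulus (twisted_sum chi beta (fun=> 1) (phi p).1 (phi p).2)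
     + 16 / B%:R * \sum_(k < B)
       modulus (twisted_sum chi beta (fun b => ((b <= k)%N)%:R) (phi p).1 (phi p).2)))).
    apply: ler_sum => -[i u] _ /=.
    under eq_bigr do rewrite twisted_charD //.
    rewrite -mulr_sumr !modulusM modulus_e modulus_char // !mul1r.
    have -> : (N + u)%:~R = N%:~R + u%:R :> 'F_q by rewrite intrD.
    have := tP i (fun b => chi ((N%:~R + u%:R) / (A + i)%:R + b%:R)).
    move=> /le_trans; apply; rewrite /twisted_sum /phi /= lerD2r.
    by under [X in _ <= modulus X]eq_bigr do rewrite mul1r.
  rewrite big_split /= -mulr_sumr exchange_big /=.
  have -> : 17 * Y = Y + 16 / B%:R * \sum_(k < B) Y.
    rewrite sumr_const card_ord -mulr_natr; field.
    by rewrite pnatr_eq0 -lt0n.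
  apply: lerD; first by apply: avg => b; rewrite modulus1.
  rewrite ler_wpM2l ?divr_ge0 //; apply: ler_sum => k _; apply: avg => b.
  by rewrite modulus_nat; case: (_ <= _)%N.
have -> : (A * B)%:R * modulus (S N H) =
    modulus (\sum_(i < A) \sum_(b < B) S N H).
  under eq_bigr do rewrite sumr_const card_ord -[_ *+ B]mulr_natr.
  rewrite sumr_const card_ord -[_ *+ A]mulr_natr !modulusM !modulus_nat natrM; ring.
under eq_bigr => i _.
  under eq_bigr => b _ do rewrite /S (interval_sum_shift _ _ _ ((A + i) * b)).
  rewrite big_split; over.
rewrite big_split /=; apply: le_trans (ler_modulusD _ _) _; apply: lerD => //.
apply: le_trans (ler_modulus_sum _ _ _) _.
apply: (@le_trans _ _ (\sum_(i < A) \sum_(b < B) (2 * M))).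
  apply: ler_sum => i _; apply: le_trans (ler_modulus_sum _ _ _) _.
  apply: ler_sum => b _; apply: le_trans (ler_modulusD _ _) _; rewrite modulusN.
  have aA : (A + i < 2 * A)%N by rewrite mul2n -addnn ltn_add2l.
  have := hM N _ _ aA (ltn_ord b); have := hM (N + H) _ _ aA (ltn_ord b); lra.
by rewrite !sumr_const !card_ord -[_ *+ B]mulr_natr -[_ *+ A]mulr_natr natrM; lra.
Qed.

End BurgessStep.

(** * Choice of the parameters *)

Section BurgessCore.
Variables (R : realType) (q : nat) (chi : 'F_q -> R[i]).
Hypotheses (q_prime : prime q) (chiM : monoid_morphism chi) (chi0 : chi 0 = 0).
Hypothesis chi_nonprincipal : exists2 x, x != 0 & chi x != 1.

(* [kappa] is [q ^ (1 / (4 (r - 1)))] and [p n] is [n ^ (1 - 1 / r)], for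
   [r = s.+2]. *)
Variables (r s : nat) (kappa eta K : R) (p : nat -> R).
Hypothesis rE : r = s.+2.
Hypotheses (kappa_ge1 : 1 <= kappa) (kappaE : kappa ^+ (4 * s.+1) = q%:R).
Hypotheses (eta_ge1 : 1 <= eta) (K_ge1 : 1 <= K).
Hypothesis harmonic_le : forall n, (0 < n <= q)%N ->
  harmonic_sum R n <= K * eta ^+ (2 * r).
Hypotheses (p_ge0 : forall n : nat, 0 <= p n) (pE : forall n, p n ^+ r = n%:R ^+ s.+1).

Definition moment_const : R := (r ^ (2 * r) + 2 * r)%:R.
(** 34 = 2 * 17, since half of the bound pays for [17 * Y] and half for the edges. 320 = 5 * 64
    joins the 5 of [card_shifted_ratios] to [H <= 64 * (A * B)], and [2 ^+ r] covers the rounding of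
    kappa ^ 2 to [B]. *)
Definition Burgess_const : R := 34 * (320 * 2 ^+ r * moment_const * K).

Let c_ge1 : 1 <= moment_const.
Proof. by rewrite /moment_const ler1n addn_gt0 rE orbC. Qed.

Let C_ge : 34 * 320 <= Burgess_const.
Proof.
rewrite /Burgess_const ler_pM2l; last by rewrite ltr0n.
rewrite -!mulrA; apply: ler_peMr; first by rewrite ler0n.
apply: mulr_ege1; first by rewrite exprn_ege1 // ler1n.
exact: mulr_ege1.
Qed.

(** [kappa ^+ (2 * s + 3)] is q ^ (1/2 + 1/(4 (r - 1))); the 2 leaves room for the number of
    integers in a real interval. The range of [H] serves to secure [4 * (A * H) <= q]. *)
Lemma Burgess_core (alpha : R) (H : nat) (N : int) :
  H%:R <= 2 * kappa ^+ (2 * s + 3) ->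
  modulus (interval_sum (twisted_char chi alpha) N H)
    <= Burgess_const * eta * kappa * p H.
Proof.
elim/ltn_ind: H N => H IH N Hk.
have r0 : (0 < r)%N by rewrite rE.
have k0 : 0 < kappa by exact: lt_le_trans kappa_ge1.
have e_pos : 0 < eta by exact: lt_le_trans eta_ge1.
have C0 : 0 < Burgess_const by apply: lt_le_trans C_ge; rewrite -natrM ltr0n.
have kn := ltW k0; have en := ltW e_pos; have Cn := ltW C0.
(* For short sums the trivial bound [H] suffices, because H ^ (1 / r) is at most 32 kappa. In the
   other case [H] exceeds [32 * B], so that [A] is positive. *)
have [HC|HC] := lerP H%:R (32 * kappa ^+ r).
  apply: (@le_trans _ _ H%:R).
    apply: le_trans (ler_modulus_sum _ _ _) _.
    apply: (@le_trans _ _ (\sum_(u < H) 1)); last by rewrite sumr_const card_ord.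
    apply: ler_sum => u _.
    by rewrite modulusM modulus_e mul1r modulus_char_le1.
  apply: (@le_trans _ _ (32 * kappa * p H)).
    rewrite -(ler_pXn2r r0) ?nnegrE ?mulr_ge0 // 2!exprMn pE.
    have -> : H%:R ^+ r = H%:R * H%:R ^+ s.+1 :> R by rewrite rE exprS.
    rewrite ler_wpM2r ?exprn_ge0 //; apply: le_trans HC _.
    rewrite ler_wpM2r ?exprn_ge0 // rE exprS ler_peMr //.
    by rewrite exprn_ege1 // ler1n.
  rewrite ler_wpM2r // ler_wpM2r //.
  apply: (@le_trans _ _ Burgess_const); last by rewrite ler_peMr.
  by apply: le_trans C_ge; rewrite -natrM ler_nat.
(* With this B the diagonal and the off-diagonal terms of the moment, which are
   [q * B ^+ r] and [sqrt q * B ^+ (2 * r - 1)], have the same order. *)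
pose B := Num.trunc (kappa ^+ 2).
have k2 : 1 <= kappa ^+ 2 by rewrite exprn_ege1.
have B0 : (0 < B)%N by rewrite truncn_gt0.
have [Bk kB] : B%:R <= kappa ^+ 2 /\ kappa ^+ 2 < B.+1%:R.
  by apply/andP; exact: truncn_itv (ltW (lt_le_trans ltr01 k2)).
have kB2 : kappa ^+ 2 <= 2 * B%:R.
  have : 1 <= B%:R :> R by rewrite ler1n.
  move: kB; rewrite -natr1; lra.
have q0 : 0 < q%:R :> R by rewrite ltr0n prime_gt0.
have B1 : 0 < B%:R :> R by rewrite ltr0n.
have sqrtq : Num.sqrt q%:R = kappa ^+ (2 * s.+1) :> R.
  rewrite -kappaE -[(4 * _)%N]/(2 * 2 * s.+1)%N -mulnA mulnC exprM sqrtr_sqr ger0_norm //.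
  by rewrite exprn_ge0.
have Bsq : B%:R ^+ s.+1 <= Num.sqrt q%:R :> R.
  by rewrite sqrtq exprM ler_pXn2r ?nnegrE ?exprn_ge0 //.
have Bq : (B <= q)%N.
  rewrite -(ler_nat R) -kappaE; apply: le_trans Bk _.
  by apply: (ler_weXn2l kappa_ge1); rewrite mulnS.
(* The 32 makes every shift, being at most [2 * A * B], at most [H / 16]. *)
pose A := (H %/ (32 * B))%N.
have H32 : (32 * B <= H)%N.
  rewrite -(ler_nat R) natrM; apply: le_trans (ltW HC).
  rewrite ler_wpM2l //; apply: le_trans Bk _.
  by apply: (ler_weXn2l kappa_ge1); rewrite rE.
have A0 : (0 < A)%N by rewrite divn_gt0 // muln_gt0.
have AB : (32 * (A * B) <= H)%N.
  by rewrite mulnCA; exact: leq_trunc_div.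
have AB' : (H <= 64 * (A * B))%N.
  have : (H < A.+1 * (32 * B))%N by apply: ltn_ceil; rewrite muln_gt0.
  move/ltnW/leq_trans; apply; rewrite -[64%N]/(2 * 32)%N -mulnACA leq_mul2r.
  by rewrite mul2n -addnn -[A.+1]addn1 leq_add2l A0 orbT.
have AH : (A <= H)%N by exact: leq_div.
have AHq : (4 * (A * H) <= q)%N.
  have h1 : H%:R ^+ 2 <= 4 * (q%:R * kappa ^+ 2) :> R.
    have -> : 4 * (q%:R * kappa ^+ 2) = (2 * kappa ^+ (2 * s + 3)) ^+ 2.
      rewrite exprMn -exprM -kappaE -exprD.
      have -> : (4 * s.+1 + 2 = (2 * s + 3) * 2)%N by clear; lia.
      by have -> : 2 ^+ 2 = 4 :> R by ring.
    by rewrite ler_pXn2r ?nnegrE ?mulr_ge0 ?exprn_ge0.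
  have h2 : H%:R ^+ 2 <= 8 * (q%:R * B%:R) :> R.
    apply: le_trans h1 _; have := ler_wpM2l (ltW q0) kB2; lra.
  move: h2; rewrite -natrX -!natrM ler_nat => h2.
  rewrite -(leq_pmul2r B0) -(leq_pmul2l (isT : 0 < 8)%N).
  have : (32 * (A * B) * H <= H * H)%N by rewrite leq_mul2r AB orbT.
  by move: h2; rewrite -mulnn; clear; lia.
pose Phi := Burgess_const * eta * kappa * p H.
have CE : 0 <= Burgess_const * eta * kappa by do 2?apply: mulr_ge0.
have Phi0 : 0 <= Phi by apply: mulr_ge0.
pose D := Burgess_const / 34 * eta * kappa.
have D0 : 0 < D by do 2?apply: mulr_gt0 => //; apply: divr_gt0.
pose Y := (A * B)%:R * (D * p H).
have Y0 : 0 <= Y by apply: mulr_ge0 => //; apply: mulr_ge0 => //; exact: ltW.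
have edges (N' : int) (a b : nat) : (a < 2 * A)%N -> (b < B)%N ->
    modulus (interval_sum (twisted_char chi alpha) N' (a * b)) <= Phi / 4.
  move=> aA bB; have ab : (16 * (a * b) <= H)%N.
    apply: leq_trans AB; have : (a * b <= 2 * A * B)%N by rewrite leq_mul // ltnW.
    clear; lia.
  have abH : (a * b < H)%N.
    have : (0 < H)%N by exact: leq_trans A0 AH.
    by move: ab; move: (a * b)%N => m; clear; lia.
  apply: le_trans (IH _ abH N' _) _.
    by apply: le_trans Hk; rewrite ler_nat ltnW.
  rewrite /Phi -[leRHS]mulrA; apply: ler_wpM2l => //.
  (* Shortening by a factor 16 divides [p] by at least 4, because 1 - 1 / r is at least 1 / 2; in
     integers, [16 ^+ s.+1] is at least [4 ^+ r]. The two edges together thus take half of [Phi]. *)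
  rewrite ler_pdivlMr // -(ler_pXn2r r0) ?nnegrE ?mulr_ge0 //.
  rewrite exprMn !pE; apply: (@le_trans _ _ ((a * b)%:R ^+ s.+1 * 16 ^+ s.+1)).
    have -> : 16 = 4 ^+ 2 :> R by ring.
    rewrite ler_wpM2l ?exprn_ge0 // -exprM; apply: ler_weXn2l; first by rewrite ler1n.
    by rewrite rE; clear; lia.
  rewrite -exprMn ler_pXn2r ?nnegrE ?mulr_ge0 // -natrM ler_nat mulnC //.
have c0 : 0 < moment_const by exact: lt_le_trans c_ge1.
have moment_le : (r ^ (2 * r) * B ^ r * B * q)%:R + B%:R ^+ (2 * r) * ((2 * r)%:R * Num.sqrt q%:R)
    <= moment_const * q%:R * B%:R ^+ s.+3.
  have -> : (2 * r = s.+3 + s.+1)%N by rewrite rE; clear; lia.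
  have -> : moment_const * q%:R * B%:R ^+ s.+3 =
     (r ^ (s.+3 + s.+1) * B ^ r * B * q)%:R + B%:R ^+ s.+3 * q%:R * (s.+3 + s.+1)%:R.
    rewrite /moment_const; have -> : (2 * r = s.+3 + s.+1)%N by rewrite rE; clear; lia.
    rewrite natrD !natrM !natrX [B%:R ^+ s.+3]exprSr rE !exprS; ring.
  rewrite lerD2l exprD.
  have Zq : B%:R ^+ s.+1 * Num.sqrt q%:R <= q%:R :> R.
    by rewrite -[leRHS]sqr_sqrtr ?ler0n // expr2 ler_wpM2r ?sqrtr_ge0.
  have : 0 <= B%:R ^+ s.+3 :> R by rewrite exprn_ge0.
  move: (B%:R ^+ s.+3) (B%:R ^+ s.+1) ((s.+3 + s.+1)%:R : R) (ler0n R (s.+3 + s.+1)) Zq.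
  move=> X Z k k_ge0 Zq X0.
  have -> : X * Z * (k * Num.sqrt q%:R) = X * k * (Z * Num.sqrt q%:R) by ring.
  have -> : X * q%:R * k = X * k * q%:R by ring.
  by rewrite ler_wpM2l // mulr_ge0.
(* This is what remains of the moment hypothesis of [Burgess_step] after cancelling the common
   powers of [A], [H] and [B]. In it [q] splits as kappa ^ (2 s) * kappa ^ (2 r): the first part is
   matched by [B ^+ s], the second by [D ^+ (2 * r)]. *)
have key : 5 * moment_const * harmonic_sum R (2 * A) * H%:R * q%:R
    <= A%:R * B%:R ^+ s.+1 * D ^+ (2 * r).
  have kk : kappa ^+ 2 ^+ s * kappa ^+ (2 * r) = q%:R.
    rewrite -exprM -exprD -kappaE; congr (_ ^+ _).
    by rewrite rE; clear; lia.
  have Bs : kappa ^+ 2 ^+ s <= 2 ^+ s * B%:R ^+ s.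
    by rewrite -exprMn; apply: lerXn2r; rewrite ?nnegrE ?mulr_ge0 ?exprn_ge0.
  have hA : harmonic_sum R (2 * A) <= K * eta ^+ (2 * r).
    apply: harmonic_le; rewrite muln_gt0 A0 /=; apply: leq_trans AHq.
    by move: A0 AH; move: (A) => A'; clear; nia.
  have CK : 320 * 2 ^+ r * moment_const * K <= (Burgess_const / 34) ^+ (2 * r).
    have -> : Burgess_const / 34 = 320 * 2 ^+ r * moment_const * K.
      by rewrite /Burgess_const; field.
    apply: ler_eXnr; first by rewrite muln_gt0.
    apply: (@le_trans _ _ 320); first by rewrite ler1n.
    by have := C_ge; rewrite /Burgess_const ler_pM2l.
  have kH : H%:R <= 64 * (A%:R * B%:R) :> R by rewrite -!natrM ler_nat.
  rewrite /D 2![in leRHS]exprMn -{}kk; move: hA Bs CK.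
  have -> : 2 ^+ r = 4 * 2 ^+ s :> R by rewrite rE !exprS; ring.
  rewrite [B%:R ^+ s.+1]exprS.
  have X0 : 0 <= kappa ^+ 2 ^+ s by rewrite !exprn_ge0.
  have W0 : 0 <= kappa ^+ (2 * r) by rewrite exprn_ge0.
  have E0 : 0 <= eta ^+ (2 * r) by rewrite exprn_ge0.
  have b0 : 0 <= B%:R ^+ s :> R by rewrite exprn_ge0.
  have T0 : 0 <= 2 ^+ s :> R by rewrite exprn_ge0.
  have K0 : 0 <= K by exact: le_trans K_ge1.
  have cc0 := ltW c0.
  have a0 := ler0n R A; have bb0 := ler0n R B; have h0 := ler0n R H.
  move: (kappa ^+ 2 ^+ s) (kappa ^+ (2 * r)) (eta ^+ (2 * r)) (2 ^+ s : R)
    ((Burgess_const / 34) ^+ (2 * r)) (harmonic_sum R (2 * A)) (A%:R : R) (B%:R : R) (H%:R : R)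
    X0 W0 E0 b0 T0 kH a0 bb0 h0.
  move=> X W E T G hh a1 b1 h1 X0 W0 E0 b0 T0 kH a0 bb0 h0 hA Bs CK.
  move: (b1 ^+ s) b0 Bs => b b0 Bs.
  apply: (@le_trans _ _ (5 * moment_const * (K * E) * h1 * (X * W))).
    by do 2![rewrite ler_wpM2r ?mulr_ge0 //]; rewrite ler_wpM2l ?mulr_ge0.
  apply: (@le_trans _ _ (5 * moment_const * (K * E) * (64 * (a1 * b1)) * ((T * b) * W))).
    apply: ler_pM; rewrite ?mulr_ge0 //; first by rewrite ler_wpM2l ?mulr_ge0.
    by rewrite ler_wpM2r.
  apply: (@le_trans _ _ ((320 * (4 * T) * moment_const * K) * (a1 * (b1 * b) * E * W))).
    have : 0 <= T * moment_const * K * (a1 * (b1 * b) * E * W) by rewrite !mulr_ge0.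
    lra.
  have -> : a1 * (b1 * b) * (G * E * W) = G * (a1 * (b1 * b) * E * W) by ring.
  by rewrite ler_wpM2r ?mulr_ge0.
have step : 17 * Y + (A * B)%:R * (2 * (Phi / 4)) = (A * B)%:R * Phi.
  by rewrite /Y /D /Phi; field.
have ABpos : 0 < (A * B)%:R :> R by rewrite ltr0n muln_gt0 A0.
rewrite -/Phi -(ler_pM2l ABpos) -step.
apply: (@Burgess_step _ _ _ q_prime chiM chi0 chi_nonprincipal _ _ _ _ _ r) => //; rewrite ?A0 ?B0 //.
apply: le_trans (ler_wpM2l _ moment_le) _.
  by rewrite !mulr_ge0 ?exprn_ge0 ?sumr_ge0.
have -> : Y ^+ (2 * r) = (A%:R * B%:R ^+ s.+1 * D ^+ (2 * r)) *
    (A%:R ^+ (2 * s + 3) * H%:R ^+ (2 * s.+1) * B%:R ^+ s.+3).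
  rewrite /Y natrM 3!exprMn.
  have -> : p H ^+ (2 * r) = H%:R ^+ (2 * s.+1).
    by rewrite mulnC exprM pE -exprM mulnC.
  have -> : A%:R ^+ (2 * r) = A%:R * A%:R ^+ (2 * s + 3) :> R.
    by rewrite -exprS; congr (_ ^+ _); rewrite rE; clear; lia.
  have -> : B%:R ^+ (2 * r) = B%:R ^+ s.+1 * B%:R ^+ s.+3 :> R.
    by rewrite -exprD; congr (_ ^+ _); rewrite rE; clear; lia.
  move: (_ ^+ s.+1) (_ ^+ s.+3) (_ ^+ (2 * s.+1)) (_ ^+ (2 * r)) (_ ^+ _) => *; ring.
have -> : (A * H)%:R ^+ (2 * r - 2) * (5 * (A * H)%:R * harmonic_sum R (2 * A)) *
     (moment_const * q%:R * B%:R ^+ s.+3) =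
   (5 * moment_const * harmonic_sum R (2 * A) * H%:R * q%:R) *
    (A%:R ^+ (2 * s + 3) * H%:R ^+ (2 * s.+1) * B%:R ^+ s.+3).
  have -> : (2 * r - 2 = 2 * s.+1)%N by rewrite rE; clear; lia.
  have -> : (2 * s + 3 = (2 * s.+1).+1)%N by clear; lia.
  rewrite natrM exprMn [A%:R ^+ (2 * s.+1).+1]exprS.
  move: (_ ^+ s.+3) (A%:R ^+ (2 * s.+1)) (H%:R ^+ (2 * s.+1)) => *; ring.
by rewrite ler_wpM2r // !mulr_ge0 ?exprn_ge0.
Qed.

End BurgessCore.

(** * Passage to real exponents and real intervals *)

Lemma harmonic_sum_le_ln (R : realType) (n : nat) :
  (0 < n)%N -> harmonic_sum R n <= 1 + ln n%:R.
Proof.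
case: n => // n _; elim: n => [|n IHn].
  by rewrite /harmonic_sum big_nat1 invr1 ln1 addr0.
rewrite /harmonic_sum big_nat_recr //= -/(harmonic_sum R n.+1).
have n1 : 0 < n.+1%:R :> R by [].
have n2 : 0 < n.+2%:R :> R by [].
apply: le_trans (lerD IHn (lexx _)) _; rewrite -addrA lerD2l.
have p0 : 0 < n.+1%:R / n.+2%:R :> R by rewrite divr_gt0.
have := expR_ge1Dx (ln (n.+1%:R / n.+2%:R : R)); rewrite lnK ?posrE //.
rewrite lnM ?posrE ?invr_gt0 // lnV ?posrE // => h.
have : n.+1%:R / n.+2%:R = 1 - n.+2%:R^-1 :> R.
  have -> : n.+1%:R = n.+2%:R - 1 :> R by rewrite -[n.+2%:R]natr1 addrK.
  by rewrite mulrBl mul1r divff ?gt_eqF.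
move=> E; move: h; rewrite E => h.
by move: (ln _) (ln _) (n.+2%:R^-1) h => a b c; lra.
Qed.

Lemma harmonic_sum_le_powR (R : realType) (t : R) (n q : nat) : 0 < t ->
  (0 < n <= q)%N -> harmonic_sum R n <= (1 + t^-1) * q%:R `^ t.
Proof.
move=> t0 /andP[n0 nq]; apply: le_trans (harmonic_sum_le_ln R n0) _.
have q0 : 0 < q%:R :> R by rewrite ltr0n (leq_trans n0).
have q1 : 1 <= q%:R :> R by rewrite ler1n (leq_trans n0).
have Q1 : 1 <= q%:R `^ t by rewrite -[leLHS](powRr0 q%:R) ler_powR // ltW.
rewrite mulrDl mul1r lerD //; apply: (@le_trans _ _ (ln q%:R)).
  by rewrite ler_ln ?ler_nat ?posrE // ltr0n.
rewrite mulrC ler_pdivlMr // mulrC -ln_powR.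
have := expR_ge1Dx (ln (q%:R `^ t)); rewrite lnK ?posrE ?powR_gt0 //; lra.
Qed.

Lemma mem_int_interval (m n : int) (h : nat) :
  (n \in [seq m + 1 + (u : nat) | u <- iota 0 h]) = (m < n <= m + h).
Proof.
apply/mapP/idP => [[u]|/andP[mn nh]].
  by rewrite mem_iota add0n => /andP[_ uh] ->; lia.
have k0 : 0 <= n - (m + 1) by lia.
exists (absz (n - (m + 1))%R); last by rewrite gez0_abs //; lia.
by rewrite mem_iota add0n -ltz_nat gez0_abs //; lia.
Qed.

Lemma mixed_character_sumE (R : realType) (f : {poly R}) (q : nat)
    (chi : 'F_q -> R[i]) (N H : R) (h : nat) : size f = 2%N ->
  Num.floor (N + H) = Num.floor N + h ->
  mixed_character_sum f chi N H =
    e f`_0 * interval_sum (twisted_char chi f`_1) (Num.floor N + 1) h.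
Proof.
move=> sf hE; rewrite /mixed_character_sum.
pose s := [seq (Num.floor N + 1 + (u : nat))%R | u <- iota 0 h].
have us : uniq s.
  by rewrite map_inj_uniq ?iota_uniq // => u v /addrI [].
have -> : [set n : int | N < n%:~R <= N + H]%classic = [set` s]%classic.
  by apply/seteqP; split => n /=; rewrite -floor_lt_int -floor_ge_int hE mem_int_interval.
rewrite -fsbig_seq // big_map -[h]subn0 -/(index_iota 0 h) big_mkord subn0.
rewrite mulr_sumr; apply: eq_bigr => u _.
have fE : f = f`_1 *: 'X + (f`_0)%:P.
  apply/polyP => i; rewrite coefD coefZ coefX coefC.
  by case: i => [|[|i]] /=; rewrite ?mulr0 ?mulr1 ?add0r ?addr0 // nth_default ?sf.
rewrite {1}fE hornerD hornerZ hornerX hornerC addrC eD /twisted_char mulrA //.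
Qed.

(* The length H is nonnegative, so that the power of H makes sense. The start
   N may be any real number if H >= 1; it has to be an integer if H < 1, since
   otherwise (N, N + H] may contain an integer for arbitrarily small H, and then
   the left-hand side is 1 while the right-hand side tends to 0 with H. *)
Theorem theorem1p4 (R : realType) (r : nat) (hr : (2 <= r)%N)
    (eps : R) (heps : 0 < eps) :
  exists C : R, 0 < C /\
    forall (f : {poly R}) (q : nat) (chi : 'F_q -> R[i]) (H N : R),
      size f = 2%N ->
      prime q ->
      multiplicative_character chi ->
      ~ principal chi ->
      0 <= H ->
      H < q%:R `^ (1 / 2 + 1 / (4 * (r%:R - 1))) ->
      N \is a Num.int \/ 1 <= H ->
      `|mixed_character_sum f chi N H|
        <= (C * (H `^ (1 - 1 / r%:R)
                 * q%:R `^ (1 / (4 * (r%:R - 1)) + eps)))%:C.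
Proof.
have [s rE] : exists s, r = s.+2 by exists r.-2; case: r hr => [|[|]].
have r0 : 0 < r%:R :> R by rewrite ltr0n rE.
have rs : r%:R - 1 = s.+1%:R :> R by rewrite rE -natr1 addrK.
have s0 : 0 < s.+1%:R :> R by [].
(* The harmonic sum enters the final bound under a 2r-th root, so a loss of q ^ t there costs only q
   ^ eps. *)
pose t : R := 2 * r%:R * eps.
have t0 : 0 < t by rewrite !mulr_gt0.
pose K := 1 + t^-1.
have K1 : 1 <= K by rewrite lerDl invr_ge0 ltW.
exists (2 * Burgess_const r K); split.
  rewrite /Burgess_const /moment_const !mulr_gt0 ?exprn_gt0 ?ltr0n //.
    by rewrite addn_gt0 orbC rE.
  exact: lt_le_trans K1.
move=> f q chi H N sf pq [chiM chi0] chi1 H0 Hlt NH.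
have q0 : 0 < q%:R :> R by rewrite ltr0n prime_gt0.
have q1 : 1 <= q%:R :> R by rewrite ler1n prime_gt0.
have chi_np : exists2 x, x != 0 & chi x != 1.
  have [x /andP[x0 cx]|all1] := pickP [pred x | (x != 0) && (chi x != 1)].
    by exists x.
  case: chi1 => x x0; have := all1 x; rewrite /= x0 /= => /negbFE/eqP //.
pose y : R := 1 - 1 / r%:R.
have yE : y * r%:R = s.+1%:R.
  by rewrite /y -rs; field; rewrite gt_eqF.
have y01 : 0 < y <= 1.
  rewrite -(pmulr_lgt0 _ r0) yE s0 /= /y gerBl divr_ge0 // ltW.
have [y0 y1] := andP y01.
pose kappa : R := q%:R `^ (1 / (4 * (r%:R - 1))).
pose eta : R := q%:R `^ eps.
pose p (n : nat) := (n%:R : R) `^ y.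
have k1 : 1 <= kappa.
  by rewrite -[leLHS](powRr0 q%:R) ler_powR // rs divr_ge0.
have kE : kappa ^+ (4 * s.+1) = q%:R.
  rewrite -powR_mulrn ?powR_ge0 // -powRrM rs natrM.
  by rewrite (_ : _ * _ = 1) ?powRr1 ?ltW //; field; rewrite ?pnatr_eq0.
have e1 : 1 <= eta by rewrite -[leLHS](powRr0 q%:R) ler_powR // ltW.
have hK n : (0 < n <= q)%N -> harmonic_sum R n <= K * eta ^+ (2 * r).
  move=> nq; apply: le_trans (harmonic_sum_le_powR t0 nq) _.
  rewrite -powR_mulrn ?powR_ge0 // -powRrM natrM /t [eps * _]mulrC //.
have p0 n : 0 <= p n by exact: powR_ge0.
have pE n : p n ^+ r = n%:R ^+ s.+1.
  by rewrite -powR_mulrn ?powR_ge0 // -powRrM yE powR_mulrn.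
have flo : Num.floor N <= Num.floor (N + H) by apply: le_floor; rewrite lerDl.
pose h := absz (Num.floor (N + H) - Num.floor N)%R.
have hE : Num.floor (N + H) = Num.floor N + h.
  by rewrite /h gez0_abs ?subr_ge0 // subrKC.
(* For an integer [N] the count is at most [H]; otherwise it is less than [H + 1], which is at most
   [2 * H] when [H] is at least 1. *)
have h2 : h%:R <= 2 * H.
  have e1' : h%:R = (Num.floor (N + H))%:~R - (Num.floor N)%:~R :> R.
    by rewrite hE intrD addrAC subrr add0r.
  rewrite e1'; have := floor_le (N + H); case: NH => [|H1].
    by rewrite intrEfloor => /eqP ->; lra.
  have := floorD1_gt N; rewrite intrD; lra.
have hk : h%:R <= 2 * kappa ^+ (2 * s + 3).
  apply: le_trans h2 _; rewrite ler_wpM2l //; apply: le_trans (ltW Hlt) _.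
  rewrite -powR_mulrn ?powR_ge0 // -powRrM rs ler_powR // natrD natrM.
  have -> : s%:R = s.+1%:R - 1 :> R by rewrite -natr1 addrK.
  by rewrite le_eqVlt; apply/orP; left; apply/eqP; field; rewrite gt_eqF.
rewrite (mixed_character_sumE chi sf hE) -modulusE modulusM modulus_e mul1r lecR.
apply: le_trans (Burgess_core pq chiM chi0 chi_np rE k1 kE e1 K1 hK p0 pE _ _ hk) _.
have ph : p h <= 2 * H `^ y.
  apply: (@le_trans _ _ ((2 * H) `^ y)); first by rewrite ge0_ler_powR ?nnegrE ?mulr_ge0 // ltW.
  rewrite powRM // ler_wpM2r ?powR_ge0 // -[leRHS]powRr1 // ler_powR //.
  by rewrite ler1n.
rewrite [q%:R `^ (_ + eps)]powRD ?(gt_eqF q0) ?implybT // -/kappa -/eta.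
have C0 : 0 <= Burgess_const r K.
  apply: mulr_ge0; first by rewrite ler0n.
  apply: mulr_ge0; last exact: le_trans ler01 K1.
  apply: mulr_ge0; last by rewrite ler0n.
  by apply: mulr_ge0; rewrite ?exprn_ge0 ?ler0n.
have kn : 0 <= kappa by exact: powR_ge0.
have en : 0 <= eta by exact: powR_ge0.
apply: (@le_trans _ _ (Burgess_const r K * eta * kappa * (2 * H `^ y))).
  by rewrite ler_wpM2l //; do 2?apply: mulr_ge0.
by rewrite le_eqVlt; apply/orP; left; apply/eqP; rewrite -/y; ring.
Qed.
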